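(* The finite satisfiability problem for $\mathrm{FO}^2_{gl\%}$ (given a sentence, decide whether it has a finite model) is undecidable. This holds even when the only percentage quantifier allowed is $\exists^{=50\%}$.
   Context: Structures are finite, over relational signatures with unary and binary relation symbols and equality. Global percentage quantifier: for a rational $0\le q\le 100$, $\mathcal{M}\models \exists^{=q\%}x\,\varphi$ (under an assignment of the other free variables) iff the number of elements $b\in M$ such that $\varphi$ holds when $x$ is assigned $b$ equals $\frac{q}{100}\cdot|M|$; analogous quantifiers with $<,\le,>,\ge$ in place of $=$. $\mathrm{FO}^2$ is the fragment of first-order logic using only the two variables $x,y$ (which may be requantified). $\mathrm{FO}^2_{gl\%}$ is $\mathrm{FO}^2$ extended with global percentage quantifiers. *)

(* Defs.v *)
From mathcomp Require Import all_boot.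
Set Implicit Arguments. Unset Strict Implicit. Unset Printing Implicit Defensive.

(* The two variables: x is [false], y is [true]. *)
Definition var := bool.

Inductive cmp := CEq | CLt | CLe | CGt | CGe.

(* Relational signature: countably many unary symbols [Pu i] and binary
   symbols [Pb i]; a formula uses finitely many of them. *)
Inductive form :=
| Pu  (i : nat) (v : var)
| Pb  (i : nat) (v w : var)
| Equ (v w : var)
| Neg (f : form)
| And (f g : form)
| Or  (f g : form)
| Ex  (v : var) (f : form)
(* [Pct c a b v f] is the global percentage quantifier  exists^{c q%} v f
   with rational percentage q = a / b. *)
| Pct (c : cmp) (a b : nat) (v : var) (f : form).

Fixpoint wf (f : form) : bool :=
  match f with
  | Pu _ _ | Pb _ _ _ | Equ _ _ => true
  | Neg g | Ex _ g => wf g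
  | And g h | Or g h => wf g && wf h
  | Pct _ a b _ g => [&& 0 < b, a <= 100 * b & wf g]
  end.

Fixpoint free (u : var) (f : form) : bool :=
  match f with
  | Pu _ v => v == u
  | Pb _ v w | Equ v w => (v == u) || (w == u)
  | Neg g => free u g
  | And g h | Or g h => free u g || free u h
  | Ex v g | Pct _ _ _ v g => (v != u) && free u g
  end.

Definition sentence (f : form) : bool :=
  [&& wf f, ~~ free false f & ~~ free true f].

Fixpoint only_half (f : form) : bool :=
  match f with
  | Pu _ _ | Pb _ _ _ | Equ _ _ => true
  | Neg g | Ex _ g => only_half g
  | And g h | Or g h => only_half g && only_half h
  | Pct c a b _ g => [&& (if c is CEq then true else false), a == 50 * b & only_half g]
  end.

Record structure (N : nat) := Structure {
  unary  : nat -> 'I_N -> bool;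
  binary : nat -> 'I_N -> 'I_N -> bool }.

Definition upd N (s : var -> 'I_N) (v : var) (d : 'I_N) : var -> 'I_N :=
  fun u => if u == v then d else s u.

Definition cmp_eval (c : cmp) (m n : nat) : bool :=
  match c with
  | CEq => m == n | CLt => m < n | CLe => m <= n
  | CGt => m > n  | CGe => m >= n
  end.

Fixpoint eval N (M : structure N) (s : var -> 'I_N) (f : form) : bool :=
  match f with
  | Pu i v => unary M i (s v)
  | Pb i v w => binary M i (s v) (s w)
  | Equ v w => s v == s w
  | Neg g => ~~ eval M s g
  | And g h => eval M s g && eval M s h
  | Or g h => eval M s g || eval M s h
  | Ex v g => [exists d : 'I_N, eval M (upd s v d) g]
  | Pct c a b v g =>
      (* #{d | g[v:=d]}  (c)  (a/b)/100 * N,  cleared of denominators *)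
      cmp_eval c (100 * b * #|[pred d : 'I_N | eval M (upd s v d) g]|) (a * N)
  end.

Definition fin_sat (f : form) : Prop :=
  exists (n : nat) (M : structure n.+1), eval M (fun _ => ord0) f.

Definition cantor (a b : nat) : nat := ((a + b) * (a + b).+1)./2 + b.

Definition enc_cmp (c : cmp) : nat :=
  match c with CEq => 0 | CLt => 1 | CLe => 2 | CGt => 3 | CGe => 4 end.

Fixpoint enc (f : form) : nat :=
  match f with
  | Pu i v => cantor 0 (cantor i v)
  | Pb i v w => cantor 1 (cantor i (cantor v w))
  | Equ v w => cantor 2 (cantor v w)
  | Neg g => cantor 3 (enc g)
  | And g h => cantor 4 (cantor (enc g) (enc h))
  | Or g h => cantor 5 (cantor (enc g) (enc h))
  | Ex v g => cantor 6 (cantor v (enc g))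
  | Pct c a b v g =>
      cantor 7 (cantor (enc_cmp c) (cantor a (cantor b (cantor v (enc g)))))
  end.

Inductive instr :=
| Inc (r : nat) (j : nat)
| Dec (r : nat) (jnz jz : nat).

Definition program := seq instr.
Definition config := (nat * (nat -> nat))%type.

Definition setreg (R : nat -> nat) (r v : nat) : nat -> nat :=
  fun k => if k == r then v else R k.

Definition step (P : program) (c : config) : config :=
  let: (pc, R) := c in
  match nth None (map Some P) pc with
  | None => c
  | Some (Inc r j) => (j, setreg R r (R r).+1)
  | Some (Dec r jnz jz) =>
      if R r is k.+1 then (jnz, setreg R r k) else (jz, R)
  end.

Definition init (n : nat) : config := (0, fun k => if k == 0 then n else 0).

Definition run (P : program) (k : nat) (n : nat) : config := iter k (step P) (init n).

Definition halted (P : program) (c : config) : bool := size P <= c.1.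

Definition rm_answers (P : program) (n : nat) (A : Prop) : Prop :=
  exists k, let c := run P k n in
    halted P c /\ ((A /\ c.2 0 = 1) \/ (~ A /\ c.2 0 = 0)).

(* Main.v *)
From mathcomp Require Import all_boot all_order ssralg ssrnum ssrint intdiv zify ring.
From Stdlib Require Import FunctionalExtensionality.
Require Import Defs.
Set Implicit Arguments. Unset Strict Implicit. Unset Printing Implicit Defensive.

(** A finite structure in which the unary predicate H holds for exactly half of the
elements can compare cardinals: for A inside H and B outside H, the set (H \ A) + B has
half of the elements iff |A| = |B|. A binary relation in which every element of A has |B|
successors in C and every element of C exactly one predecessor in A forces
|C| = |A| |B|. So every system of equations x = 1, x + y = z, x y = z becomes a sentence
whose finite models code the solutions of the system, and undecidability amounts to the
Davis-Putnam-Robinson-Matiyasevich theorem. The latter is obtained as usual: the solutions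
of Pell equations make exponentiation Diophantine; hence so is the bitwise order
("the binomial coefficient is odd"), and hence so is the existence of a halting run of a
register machine, a run being coded by the digit sequences of its registers and of its
transitions in a large base.

Since the decision procedures are themselves register machines, the contradiction comes
from a self-referential sentence. Given P, let Q compute from m = enc g the number
enc (And g (numeral m)), where numeral m says that the input of the system described by g
is m, and then run P. If g says "Q halts with output 0 on the input", then
And g (numeral (enc g)) has a finite model iff P answers 0 on it. *)

(** * The Pell equation x^2 - (a^2 - 1) y^2 = 1 *)

Section Pell.
Import Order.TTheory GRing.Theory Num.Theory.
Local Open Scope ring_scope.

(** The pair (x, y) is read off (a + sqrt d)^n = x + y sqrt d with d = a^2 - 1. *)
Fixpoint pell (a : int) (n : nat) : int * int :=
  if n is n'.+1 then
    let: (x, y) := pell a n' in (a * x + (a ^+ 2 - 1) * y, x + a * y)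
  else (1, 0).

Definition pellx a n := (pell a n).1.
Definition pelly a n := (pell a n).2.

Lemma pellxS a n : pellx a n.+1 = a * pellx a n + (a ^+ 2 - 1) * pelly a n.
Proof. by rewrite /pellx /pelly /=; case: (pell a n). Qed.

Lemma pellyS a n : pelly a n.+1 = pellx a n + a * pelly a n.
Proof. by rewrite /pellx /pelly /=; case: (pell a n). Qed.

Lemma pell_norm a n : pellx a n ^+ 2 - (a ^+ 2 - 1) * pelly a n ^+ 2 = 1.
Proof.
elim: n => [|n IHn]; first by rewrite /pellx /pelly /=; ring.
by rewrite pellxS pellyS -[RHS]IHn; ring.
Qed.

Lemma pellD a m n :
  pellx a (m + n) = pellx a m * pellx a n + (a ^+ 2 - 1) * pelly a m * pelly a n
  /\ pelly a (m + n) = pellx a m * pelly a n + pelly a m * pellx a n.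
Proof.
elim: n => [|n [IHx IHy]]; first by rewrite addn0 /pellx /pelly /=; split; ring.
by rewrite addnS !pellxS !pellyS IHx IHy; split; ring.
Qed.

Lemma pellxD a m n :
  pellx a (m + n) = pellx a m * pellx a n + (a ^+ 2 - 1) * pelly a m * pelly a n.
Proof. by case: (pellD a m n). Qed.

Lemma pellyD a m n :
  pelly a (m + n) = pellx a m * pelly a n + pelly a m * pellx a n.
Proof. by case: (pellD a m n). Qed.

Lemma pell_ge0 a n : 1 < a -> 0 < pellx a n /\ n%:Z <= pelly a n.
Proof.
move=> a1; elim: n => [|n [IHx IHy]]; first by rewrite /pellx /pelly.
rewrite pellxS pellyS; split; nia.
Qed.

Lemma pelly_lt a m n : 1 < a -> (m < n)%N -> pelly a m < pelly a n.
Proof.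
move=> a1; elim: n => // n IHn; rewrite ltnS leq_eqVlt => lemn.
have [x0 y0] := pell_ge0 n a1.
have : pelly a n < pelly a n.+1 by rewrite pellyS; nia.
by case/orP: lemn => [/eqP-> //|/IHn lt1]; apply: lt_trans.
Qed.

Lemma pelly_le a m n : 1 < a -> (m <= n)%N -> pelly a m <= pelly a n.
Proof.
by move=> a1; rewrite leq_eqVlt => /orP[/eqP->|/(pelly_lt a1)/ltW].
Qed.

(** From a > 2 follows a^2 - 1 > 4. The factor 2 is the room that [small_dvdz_eq] needs to compare
    values of y up to sign modulo x_m. *)
Lemma pelly_lt_x a n : 2 < a -> 2 * pelly a n < pellx a n.
Proof.
move=> a2; have [|x0 y0] := @pell_ge0 a n _; first lia.
have := pell_norm a n; nia.
Qed.

(** Descent: multiplying x + y sqrt d by a - sqrt d, the inverse of the fundamental solution, gives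
    a nonnegative solution with smaller y as long as y > 0. *)
Lemma pell_solution (a x y : int) : 1 < a -> 0 <= x -> 0 <= y ->
  x ^+ 2 - (a ^+ 2 - 1) * y ^+ 2 = 1 -> exists n, x = pellx a n /\ y = pelly a n.
Proof.
move=> a1 x0 y0; have [n le_yn] : exists n, y < n%:Z by exists `|y|.+1; lia.
elim: n x y x0 y0 le_yn => [|n IHn] x y x0 y0 le_yn eq1; first lia.
have [y00|yn0] := eqVneq y 0.
  by exists 0%N; rewrite /pellx /pelly /=; split=> //; nia.
have y1 : 0 < y by lia.
have lexay : x <= a * y by nia.
have ltxay : (a - 1) * y < x by nia.
have [||||k [ex ey]] := IHn (a * x - (a ^+ 2 - 1) * y) (a * y - x).
- nia.
- lia.
- lia.
- by rewrite -[RHS]eq1; ring.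
by exists k.+1; rewrite pellxS pellyS -ex -ey; split; ring.
Qed.

(** By the norm equation x_n is a unit modulo y_n, hence modulo every divisor of y_n. *)
Lemma pell_gauss a n (p z : int) :
  (p %| pelly a n)%Z -> (p %| pellx a n * z)%Z -> (p %| z)%Z.
Proof.
move=> py pxz.
have -> : z = pellx a n * (pellx a n * z)
              - (a ^+ 2 - 1) * pelly a n * z * pelly a n.
  by rewrite -[LHS]mul1r -[X in X * z = _](pell_norm a n); ring.
by apply: rpredB; apply: dvdz_mull.
Qed.

Lemma pelly_dvd a m q : (pelly a m %| pelly a (m * q))%Z.
Proof.
elim: q => [|q IHq]; first by rewrite muln0 dvdz0.
by rewrite mulnS pellyD; apply: rpredD; [apply: dvdz_mull | apply: dvdz_mulr].
Qed.

(* First order expansion of (x_m + y_m sqrt d)^q in the ideal of y_m^2. *)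
Lemma pell_mul_modsq a m q :
  (pelly a m ^+ 2 %| pellx a (m * q) - pellx a m ^+ q)%Z /\
  (pelly a m ^+ 2 %| pellx a m * pelly a (m * q)
                     - q%:Z * pellx a m ^+ q * pelly a m)%Z.
Proof.
elim: q => [|q [/dvdzP[e IHx] /dvdzP[f IHy]]].
  by rewrite muln0 /pellx /pelly /= expr0 subrr !mul0r mulr0 subrr dvdz0.
have /dvdzP[g yq] := pelly_dvd a m q.
rewrite mulnSr pellxD pellyD.
set x := pellx a m in IHx IHy *; set y := pelly a m in IHx IHy yq *.
have {}IHx : pellx a (m * q) = x ^+ q + e * y ^+ 2 by rewrite -IHx; ring.
have {}IHy : x * pelly a (m * q) = q%:Z * x ^+ q * y + f * y ^+ 2.
  by rewrite -IHy; ring.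
split; apply/dvdzP.
  exists (e * x + (a ^+ 2 - 1) * g); rewrite IHx yq (exprS x q); ring.
exists (x * e * y + f * x).
have -> : x * (pellx a (m * q) * y + pelly a (m * q) * x) =
  x * pellx a (m * q) * y + (x * pelly a (m * q)) * x by ring.
have -> : q.+1%:Z = q%:Z + 1 by lia.
rewrite IHy IHx (exprS x q); ring.
Qed.

(** With r the remainder of n modulo m, y_m divides y_r < y_m, so y_r = 0 and r = 0. *)
Lemma pelly_dvd_index a m n : 1 < a -> (0 < m)%N ->
  (pelly a m %| pelly a n)%Z -> (m %| n)%N.
Proof.
move=> a1 m0; rewrite {1}(divn_eq n m) mulnC pellyD => dvd_y.
set q := (n %/ m)%N in dvd_y.
have dvd_r : (pelly a m %| pelly a (n %% m))%Z.
  apply: (@pell_gauss a (m * q)); first exact: pelly_dvd.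
  rewrite -[X in (_ %| X)%Z](addrK (pelly a (m * q) * pellx a (n %% m))).
  by apply: rpredB => //; apply: dvdz_mulr; apply: pelly_dvd.
have lt_r := @pelly_lt a (n %% m) m a1 (ltn_pmod n m0).
have [_ r0] := pell_ge0 (n %% m) a1.
have : pelly a (n %% m) = 0.
  case/dvdzP: dvd_r => z; case: (ltrgtP z 0) => [|| ->]; nia.
by rewrite /dvdn => y0; lia.
Qed.

(** For n = m q the first order expansion leaves y_m dividing q x_m^q, and x_m is a unit modulo
    y_m. *)
Lemma pelly_sqr_dvd_index a m n : 1 < a -> (0 < m)%N ->
  (pelly a m ^+ 2 %| pelly a n)%Z -> (pelly a m %| n%:Z)%Z.
Proof.
move=> a1 m0 dvd_y.
have /dvdnP[q nE] : (m %| n)%N.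
  apply: (pelly_dvd_index a1 m0); apply: dvdz_trans dvd_y.
  by rewrite expr2 dvdz_mulr.
have [_ ym0] := pell_ge0 m a1.
rewrite {n}nE mulnC in dvd_y *; rewrite PoszM dvdz_mull //.
have [_] := pell_mul_modsq a m q.
rewrite rpredBC => dvd_q.
have : (pelly a m ^+ 2 %| q%:Z * pellx a m ^+ q * pelly a m)%Z.
  rewrite -[X in (_ %| X)%Z](subrK (pellx a m * pelly a (m * q))).
  by apply: rpredD => //; apply: dvdz_mull.
rewrite expr2 dvdz_mul2r; last lia.
rewrite mulrC; elim: (q in X in pellx a m ^+ X) => [|k IHk].
  by rewrite expr0 mul1r.
by rewrite exprS -mulrA => /(pell_gauss (dvdzz _)).
Qed.

(** For q = y_m the linear term of the expansion is a multiple of y_m^2 too. *)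
Lemma pelly_sqr_dvd a m : 1 < a ->
  (pelly a m ^+ 2 %| pelly a (m * `|pelly a m|%N))%Z.
Proof.
move=> a1; have [_ y0] := pell_ge0 m a1.
set q := `|pelly a m|%N; have [_ dvd_q] := pell_mul_modsq a m q.
have qE : q%:Z = pelly a m by rewrite /q; lia.
have /dvdzP[g yq] := pelly_dvd a m q.
have {}dvd_q : (pelly a m ^+ 2 %| pellx a m * pelly a (m * q))%Z.
  rewrite -[X in (_ %| X)%Z](subrK (q%:Z * pellx a m ^+ q * pelly a m)).
  apply: rpredD => //; rewrite qE; apply/dvdzP; exists (pellx a m ^+ q); ring.
rewrite yq expr2 in dvd_q *; have [y00|y1] := eqVneq (pelly a m) 0.
  by rewrite y00 mulr0 dvdz0.
move: dvd_q; rewrite mulrA !dvdz_mul2r //.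
exact: pell_gauss (dvdzz _).
Qed.

(** Both sequences are integer polynomials in the base. *)
Lemma pell_cong_base a b n : (a - b %| pellx a n - pellx b n)%Z /\
  (a - b %| pelly a n - pelly b n)%Z.
Proof.
elim: n => [|n [/dvdzP[e IHx] /dvdzP[f IHy]]]; first by rewrite !subrr dvdz0.
have {}IHx : pellx a n = pellx b n + e * (a - b) by rewrite -IHx; ring.
have {}IHy : pelly a n = pelly b n + f * (a - b) by rewrite -IHy; ring.
split; apply/dvdzP; rewrite ?pellxS ?pellyS IHx IHy.
  exists (pellx b n + e * a + (a + b) * pelly b n + f * (a ^+ 2 - 1)).
  ring.
exists (e + pelly b n + f * a); ring.
Qed.

(** In base 1, where d = 0, y_n is n. *)
Lemma pelly_cong_index a n : (a - 1 %| pelly a n - n%:Z)%Z.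
Proof.
have [_ cong] := pell_cong_base a 1 n.
suff yn : pelly 1 n = n%:Z by rewrite -yn.
have [_ ->] : pellx 1 n = 1 /\ pelly 1 n = n%:Z; last by [].
elim: n {cong} => [|n [IHx IHy]]; first by rewrite /pellx /pelly.
by rewrite pellxS pellyS IHx IHy; split; lia.
Qed.

(* y is antiperiodic modulo x_m with antiperiod 2m, because x_{2m} = 2 x_m^2 - 1
   and y_{2m} = 2 x_m y_m. *)
Lemma pelly_mod_x a m n : (0 < m)%N -> exists j,
  [/\ (j <= m)%N,
      (m %| n + j)%N \/ (exists k, n = m * k + j)%N &
      (pellx a m %| pelly a n - pelly a j)%Z \/
      (pellx a m %| pelly a n + pelly a j)%Z].
Proof.
move=> m0; elim/ltn_ind: n => n IHn.
have [le_nm|lt_mn] := leqP n m.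
  exists n; split=> //; [by right; exists 0%N; rewrite muln0|].
  by left; rewrite subrr dvdz0.
have [le_n2m|lt_2mn] := leqP n (2 * m).
  (* Reflection about m: modulo x_m one has x_{2m} = -1 and y_{2m} = 0, so y_{2m-j} = y_j. *)
  exists (2 * m - n)%N; split; first lia.
    by left; apply/dvdnP; exists 2%N; lia.
  left; set j := (_ - _)%N; have nE : (n + j = m + m)%N by rewrite /j; lia.
  have := pellxD a m m; have := pellyD a m m.
  rewrite -nE pellxD pellyD => ey ex; apply/dvdzP.
  exists (2 * pellx a j * pelly a m - 2 * pelly a j * pellx a m).
  have nj := pell_norm a j; have nm := pell_norm a m.
  have -> : pelly a n = (pellx a n * pelly a j + pelly a n * pellx a j) * pellx a j
     - (pellx a n * pellx a j + (a ^+ 2 - 1) * pelly a n * pelly a j) * pelly a j.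
    by rewrite -[LHS]mulr1 -[in LHS]nj; ring.
  rewrite ey ex; have -> : (a ^+ 2 - 1) * pelly a m * pelly a m = pellx a m ^+ 2 - 1.
    by rewrite -[X in _ = _ - X]nm; ring.
  ring.
have [|j [lejm jn jy]] := IHn (n - (m + m))%N; first lia.
exists j; split=> //.
  case: jn => [/dvdnP[k kE]|[k kE]].
    by left; apply/dvdnP; exists k.+2; lia.
  by right; exists k.+2; lia.
have nE : n = ((n - (m + m)) + (m + m))%N by lia.
(* The sign coming from the antiperiod swaps the two alternatives of the induction hypothesis. *)
have /dvdzP[z zE] : (pellx a m %| pelly a n + pelly a (n - (m + m)))%Z.
  rewrite {1}nE pellyD pellxD pellyD; set i := (n - _)%N.
  have -> : (a ^+ 2 - 1) * pelly a m * pelly a m = pellx a m ^+ 2 - 1.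
    by rewrite -[X in _ = _ - X](pell_norm a m); ring.
  apply/dvdzP; exists (2 * pellx a i * pelly a m + 2 * pelly a i * pellx a m); ring.
case: jy => /dvdzP[t tE]; [right|left]; apply/dvdzP; exists (z - t);
  rewrite mulrBl -zE -tE; ring.
Qed.

Lemma eqn_mod_dvdz (d m n : nat) :
  (m = n %[mod d])%N <-> (d%:Z %| m%:Z - n%:Z)%Z.
Proof.
rewrite -eqz_mod_dvd !modz_nat eqz_nat; split=> [->//|/eqP//].
Qed.

Lemma pell_eq_nat (a x y : nat) : (1 < a)%N ->
  (x * x + y * y = 1 + a * a * y * y)%N <->
  exists n, x%:Z = pellx a n /\ y%:Z = pelly a n.
Proof.
move=> a1; split=> [eq1|[n [xE yE]]].
  by apply: pell_solution; rewrite ?expr2; lia.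
by have := pell_norm a n; rewrite -xE -yE !expr2; lia.
Qed.

Lemma small_dvdz (d z : int) : (d %| z)%Z -> `|z| < d -> z = 0.
Proof. by case/dvdzP=> q ->; case: (ltrgtP q 0) => [|| ->]; nia. Qed.

Lemma small_dvdz_eq (d x y : int) : 0 <= x -> 0 <= y -> 2 * x < d -> 2 * y < d ->
  (d %| x - y)%Z \/ (d %| x + y)%Z -> x = y.
Proof. by move=> x0 y0 xd yd [/small_dvdz|/small_dvdz]; lia. Qed.

(* The modulus s = x_m(a) pins down y among the y_n(a), the modulus U pins down
   the index; w links the two moduli through y_n(w) = y_n(a) mod s and
   y_n(w) = n mod U. *)
Definition pelly_spec (a k y t u s r e w x' y' : nat) : Prop :=
  [/\ (t * t + u * u = 1 + a * a * u * u)%N, (2 * y < u)%N & (2 * k < u)%N] /\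
  [/\ (s * s + r * r = 1 + a * a * r * r)%N, (0 < r)%N & r = (u * u * e)%N] /\
  [/\ (1 < w)%N, (w = a %[mod s])%N & (w = 1 %[mod u])%N] /\
  [/\ (x' * x' + y' * y' = 1 + w * w * y' * y')%N,
      (y' = y %[mod s])%N & (y' = k %[mod u])%N].

(** Since [u] divides the index [m] of [r], the index [n] and its representative [j] agree up to
    sign modulo [u]. Now y = ±y_j modulo [s] forces y = y_j, and k = ±j modulo [u] forces k = j,
    because all these numbers are below half of the modulus. *)
Lemma pelly_spec_sound (a k y t u s r e w x' y' : nat) : (2 < a)%N ->
  pelly_spec a k y t u s r e w x' y' -> y%:Z = pelly a k.
Proof.
move=> a2; have a1 : (1 < a)%N by lia.
have a1z : 1 < a%:Z by lia.
case=> [[/(pell_eq_nat _ _ a1)[K [_ uE]] ltyu ltku]].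
case=> [[/(pell_eq_nat _ _ a1)[m [sE rE]] r0 urE]].
case=> [[w1 /eqn_mod_dvdz wa /eqn_mod_dvdz wu]].
case=> [/(pell_eq_nat _ _ w1)[n [_ y'E]] /eqn_mod_dvdz y's /eqn_mod_dvdz y'u].
have K0 : (0 < K)%N by case: K uE => // uE; move: uE; rewrite /pelly /=; lia.
have m0 : (0 < m)%N by case: m rE {sE} => // rE; move: rE; rewrite /pelly /=; lia.
have um : (u%:Z %| m%:Z)%Z.
  rewrite uE; apply: pelly_sqr_dvd_index => //.
  by rewrite -uE -rE; apply/dvdzP; exists e%:Z; nia.
have [j [lejm jn jy]] := pelly_mod_x a n m0.
have [_ cwa] := pell_cong_base w a n; rewrite -y'E in cwa.
have := pelly_lt_x m (a2 : 2 < a%:Z); rewrite -sE -rE => ltrs.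
have lejr := pelly_le a1z lejm; rewrite -rE in lejr.
have [_ lejY] := pell_ge0 j a1z.
have leur : (u <= r)%N.
  by apply: dvdn_leq => //; rewrite urE -mulnA dvdn_mulr.
have yj : y%:Z = pelly a j.
  apply: (@small_dvdz_eq s) => //; try by clear -ltrs lejr lejY leur ltyu; lia.
  have /dvdzP[q1 e1] := dvdz_trans wa cwa.
  case/dvdzP: y's => q2 e2; rewrite -sE in jy.
  case: jy => /dvdzP[q3 e3]; [left|right]; apply/dvdzP; exists (q1 + q3 - q2);
    rewrite mulrBl mulrDl -e1 -e2 -e3; ring.
suff /eqP : k%:Z = j%:Z by rewrite eqz_nat => /eqP->.
apply: (@small_dvdz_eq u) => //; try by clear -lejY ltyu ltku yj; lia.
case/dvdzP: (dvdz_trans wu (pelly_cong_index w n)) => q1; rewrite -y'E => e1.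
case/dvdzP: y'u => q2 e2; case/dvdzP: um => q3 e3.
case: jn => [/dvdnP[q nE]|[q nE]]; [right|left]; apply/dvdzP;
  exists (q1 - q2 + q%:Z * q3); rewrite mulrDl mulrBl -e1 -e2 -mulrA -e3;
  clear -nE; lia.
Qed.

Lemma pelly_spec_complete (a k y : nat) : (2 < a)%N -> y%:Z = pelly a k ->
  exists t u s r e w x' y', pelly_spec a k y t u s r e w x' y'.
Proof.
move=> a2 yE; have a1 : (1 < a)%N by lia.
have a1z : 1 < a%:Z by lia.
have pellN b n : (1 < b)%N -> exists x y : nat,
    [/\ (x * x + y * y = 1 + b * b * y * y)%N,
        x%:Z = pellx b n, y%:Z = pelly b n & (n <= y)%N].
  move=> b1; have [x0 y0] := @pell_ge0 b%:Z n b1.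
  have ex : `|pellx b n|%:Z = pellx b n by lia.
  have ey : `|pelly b n|%:Z = pelly b n by lia.
  by exists `|pellx b n|%N, `|pelly b n|%N; split=> //; [apply/pell_eq_nat => //; exists n|lia].
(* As y_n >= n, this index puts [u] above both 2y and 2k. *)
have [t [u [eqtu tE uE leu]]] := pellN a (2 * y + 2 * k).+1 a1.
set K := (_).+1 in tE uE leu.
(* Since u = y_K, the index K u makes u^2 divide [r]. *)
have [s [r [eqsr sE rE ler]]] := pellN a (K * u)%N a1.
have r0 : (0 < r)%N by rewrite /K in ler leu; nia.
have [e eE] : exists e, r = (e * (u * u))%N.
  apply/dvdnP; have := pelly_sqr_dvd K a1z.
  by rewrite -uE absz_nat -rE dvdzE expr2 abszM !absz_nat.
have ssE : (s * s + r * r = 1 + (a * a) * (r * r))%N by rewrite eqsr !mulnA.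
have ltas : (a <= s * s)%N.
  have h1 : (a * a - 1 <= (a * a - 1) * (r * r))%N by rewrite leq_pmulr ?muln_gt0 ?r0.
  have h2 : (3 * a <= a * a)%N by rewrite leq_mul2r a2 orbT.
  by rewrite mulnBl mul1n in h1; clear -h1 h2 ssE a1; lia.
(* Chinese remainders: s^2 is 0 modulo [s] and 1 modulo [u], so [w] is [a] modulo [s] and 1 modulo
   [u]. By [ltas] the subtraction is exact. *)
pose w := (a + (s * s) * (s * s - a))%N.
have wE : w%:Z = a%:Z + (s%:Z * s%:Z) * (s%:Z * s%:Z - a%:Z).
  by rewrite /w PoszD PoszM -subzn // PoszM.
have w1 : (1 < w)%N by rewrite /w; clear -a1; lia.
have wa : (s%:Z %| w%:Z - a%:Z)%Z.
  by apply/dvdzP; exists (s%:Z * (s%:Z * s%:Z - a%:Z)); rewrite wE; ring.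
have wu : (u%:Z %| w%:Z - 1)%Z.
  have sZ : s%:Z * s%:Z - 1 = (a%:Z * a%:Z - 1) * (r%:Z * r%:Z).
    by clear -ssE; lia.
  have rZ : r%:Z = e%:Z * (u%:Z * u%:Z) by rewrite eE !PoszM.
  have -> : w%:Z - 1 = (s%:Z * s%:Z - 1) * (s%:Z * s%:Z - a%:Z + 1).
    by rewrite wE; ring.
  rewrite sZ {1}rZ; apply/dvdzP.
  exists ((a%:Z * a%:Z - 1) * e%:Z * r%:Z * u%:Z * (s%:Z * s%:Z - a%:Z + 1)).
  ring.
have [x' [y' [eqxy x'E y'E ley']]] := pellN w k w1.
exists t, u, s, r, e, w, x', y'; split; last split; last split.
- by split=> //; rewrite /K in leu; clear -leu; lia.
- by split=> //; rewrite eE mulnC.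
- by split=> //; apply/eqn_mod_dvdz.
split=> //; apply/eqn_mod_dvdz.
  by have [_] := pell_cong_base w a k; rewrite -y'E -yE; apply: dvdz_trans.
by have := pelly_cong_index w k; rewrite -y'E; apply: dvdz_trans.
Qed.
End Pell.

(** * Diophantine relations *)

Inductive dsys :=
| DOne (i : nat)
| DAdd (i j k : nat)
| DMul (i j k : nat)
| DAnd (f g : dsys).

Fixpoint dsat (f : dsys) (v : nat -> nat) : Prop :=
  match f with
  | DOne i => v i = 1
  | DAdd i j k => v i + v j = v k
  | DMul i j k => v i * v j = v k
  | DAnd g h => dsat g v /\ dsat h v
  end.

Fixpoint dren (r : nat -> nat) (f : dsys) : dsys :=
  match f with
  | DOne i => DOne (r i)
  | DAdd i j k => DAdd (r i) (r j) (r k)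
  | DMul i j k => DMul (r i) (r j) (r k)
  | DAnd g h => DAnd (dren r g) (dren r h)
  end.

Lemma dsat_ren r f v : dsat (dren r f) v <-> dsat f (v \o r).
Proof.
by elim: f => [i|i j k|i j k|g IHg h IHh] //=; rewrite IHg IHh.
Qed.

(* Parameters sit at the even positions, existential witnesses at the odd ones. *)
Definition merge (v w : nat -> nat) : nat -> nat :=
  fun i => if odd i then w i./2 else v i./2.

Lemma merge_even v w i : merge v w i.*2 = v i.
Proof. by rewrite /merge odd_double doubleK. Qed.

Lemma merge_odd v w i : merge v w i.*2.+1 = w i.
Proof. by rewrite /merge /= odd_double /= uphalf_double. Qed.

Definition mergeE := (merge_even, merge_odd).

Lemma odd_even_ind (P : nat -> Prop) :
  (forall i, P i.*2) -> (forall i, P i.*2.+1) -> forall i, P i.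
Proof.
move=> P0 P1 i; rewrite -[i]odd_double_half; case: (odd i).
  by rewrite add1n.
by rewrite add0n.
Qed.

Lemma funext_odd_even (v w : nat -> nat) :
  (forall i, v i.*2 = w i.*2) -> (forall i, v i.*2.+1 = w i.*2.+1) -> v = w.
Proof. by move=> e0 e1; apply: functional_extensionality; apply: odd_even_ind. Qed.

Definition dio (R : (nat -> nat) -> Prop) : Prop :=
  exists f, forall v, R v <-> exists w, dsat f (merge v w).

Lemma dio_ext R R' : (forall v, R v <-> R' v) -> dio R -> dio R'.
Proof. by move=> RR' [f fP]; exists f => v; rewrite -RR'. Qed.

Lemma dio_ren r R : dio R -> dio (fun v => R (v \o r)).
Proof.
case=> f fP; pose s i := if odd i then i else (r i./2).*2.
have sE v w : merge v w \o s = merge (v \o r) w.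
  apply: funext_odd_even => i; rewrite !mergeE /s /=.
    by rewrite odd_double /= doubleK mergeE.
  by rewrite odd_double /= mergeE.
exists (dren s f) => v; rewrite fP.
by split=> -[w]; [rewrite -sE|rewrite dsat_ren sE]; exists w; rewrite ?dsat_ren.
Qed.

Lemma dio_one i : dio (fun v => v i = 1).
Proof.
exists (DOne i.*2) => v; rewrite /=.
by split=> [?|[w]]; [exists id|]; rewrite !mergeE.
Qed.

Lemma dio_addv i j k : dio (fun v => v i + v j = v k).
Proof.
exists (DAdd i.*2 j.*2 k.*2) => v; rewrite /=.
by split=> [?|[w]]; [exists id|]; rewrite !mergeE.
Qed.

Lemma dio_mulv i j k : dio (fun v => v i * v j = v k).
Proof.
exists (DMul i.*2 j.*2 k.*2) => v; rewrite /=.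
by split=> [?|[w]]; [exists id|]; rewrite !mergeE.
Qed.

Section Connectives.
Let ren_odd (s : nat -> nat) i := if odd i then (s i./2).*2.+1 else i.

Let merge_ren_odd s v w : merge v w \o ren_odd s = merge v (w \o s).
Proof.
apply: funext_odd_even => i; rewrite !mergeE /ren_odd /= odd_double /=.
  by rewrite mergeE.
by rewrite uphalf_double mergeE.
Qed.

Let dsat_ren_odd s f v w :
  dsat (dren (ren_odd s) f) (merge v w) <-> dsat f (merge v (w \o s)).
Proof. by rewrite dsat_ren merge_ren_odd. Qed.

(** The systems must not share witnesses: those of [f] move to even witness positions, those of [g]
    to odd ones. *)
Lemma dio_and R R' : dio R -> dio R' -> dio (fun v => R v /\ R' v).
Proof.
case=> f fP [g gP]; pose e i := i.*2; pose o i := i.*2.+1.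
exists (DAnd (dren (ren_odd e) f) (dren (ren_odd o) g)) => v.
rewrite fP gP /=; split=> [[[w fw] [u gu]]|[w]].
  exists (merge w u); rewrite !dsat_ren_odd.
  have -> : merge w u \o e = w.
    by apply: functional_extensionality => i /=; rewrite mergeE.
  suff -> : merge w u \o o = u by [].
  by apply: functional_extensionality => i /=; rewrite mergeE.
by rewrite !dsat_ren_odd => -[fw gw]; split; [exists (w \o e)|exists (w \o o)].
Qed.

(* Existential quantification over infinitely many witnesses at once; a system
   only mentions finitely many of them. *)
Lemma dio_exs (R : (nat -> nat) -> (nat -> nat) -> Prop) :
  dio (fun u => R (fun i => u i.*2.+1) (fun i => u i.*2)) ->
  dio (fun v => exists w, R w v).
Proof.
case=> f fP.
(* The new witness sequence interleaves the quantified sequence (even places) with the old witnesses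
   (odd places). *)
pose r i := if odd i then (i./2.*2.+1).*2.+1 else
            if odd i./2 then (i./2./2.*2).*2.+1 else i./2.
have rE v w u : merge v (merge w u) \o r = merge (merge v w) u.
  apply: functional_extensionality => i /=; move: i; apply: odd_even_ind => i.
    rewrite mergeE; move: i; apply: odd_even_ind => i; rewrite mergeE.
      by rewrite /r odd_double doubleK odd_double mergeE.
    by rewrite /r odd_double doubleK /= odd_double /= uphalf_double !mergeE.
  by rewrite /r /= odd_double /= uphalf_double !mergeE.
have fun2 (v w : nat -> nat) :
    (fun i => merge v w i.*2.+1) = w /\ (fun i => merge v w i.*2) = v.
  by split; apply: functional_extensionality => i; rewrite mergeE.
exists (dren r f) => v; split=> [[w Rwv]|[u]].
  have [u fu] : exists u, dsat f (merge (merge v w) u).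
    by apply/fP; have [-> ->] := fun2 v w.
  by exists (merge w u); rewrite dsat_ren rE.
have -> : u = merge (fun i => u i.*2) (fun i => u i.*2.+1).
  by apply: funext_odd_even => i; rewrite mergeE.
set w := fun i => u i.*2; set t := fun i => u i.*2.+1.
rewrite dsat_ren rE => fwt; exists w.
have /fP : exists u, dsat f (merge (merge v w) u) by exists t.
by have [-> ->] := fun2 v w.
Qed.

End Connectives.

Definition scons (x : nat) (v : nat -> nat) (i : nat) := if i is j.+1 then v j else x.

Lemma dio_ex (R : nat -> (nat -> nat) -> Prop) :
  dio (fun v => R (v 0) (fun i => v i.+1)) -> dio (fun v => exists x, R x v).
Proof.
move=> dR; apply: (@dio_ext (fun v => exists w : nat -> nat, R (w 0) v)).
  by move=> v; split=> [[w]|[x]]; [exists (w 0)|exists (fun=> x)].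
apply: (@dio_exs (fun w v => R (w 0) v)).
have := dio_ren (fun i => if i is j.+1 then j.*2 else 1) dR.
by apply: dio_ext.
Qed.

(** * Polynomial expressions and equations *)

Inductive dterm :=
| TVar (i : nat) | TConst (c : nat) | TAdd (s t : dterm) | TMul (s t : dterm).

Fixpoint teval (t : dterm) (v : nat -> nat) : nat :=
  match t with
  | TVar i => v i
  | TConst c => c
  | TAdd s t => teval s v + teval t v
  | TMul s t => teval s v * teval t v
  end.

(** A property of functions rather than of terms, so that proof search recognises polynomials in
    ordinary arithmetic notation. *)
Definition dex (e : (nat -> nat) -> nat) := exists t, forall v, e v = teval t v.

Lemma dex_var i : dex (fun v => v i).
Proof. by exists (TVar i). Qed.

Lemma dex_const c : dex (fun=> c).
Proof. by exists (TConst c). Qed.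

Lemma dex_add a b : dex a -> dex b -> dex (fun v => a v + b v).
Proof. by case=> s sP [t tP]; exists (TAdd s t) => v /=; rewrite sP tP. Qed.

Lemma dex_mul a b : dex a -> dex b -> dex (fun v => a v * b v).
Proof. by case=> s sP [t tP]; exists (TMul s t) => v /=; rewrite sP tP. Qed.

Lemma dex_succ a : dex a -> dex (fun v => (a v).+1).
Proof. by case=> t tP; exists (TAdd t (TConst 1)) => v /=; rewrite tP addn1. Qed.

Lemma dex_ren r a : dex a -> dex (fun v => a (fun i => v (r i))).
Proof.
case=> t tP; pose fix ren t := match t with
  | TVar i => TVar (r i) | TConst c => TConst c
  | TAdd s t => TAdd (ren s) (ren t) | TMul s t => TMul (ren s) (ren t) end.
exists (ren t) => v; rewrite tP; elim: t {tP} => //= s -> t -> //.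
Qed.

Lemma dex_sum (I : Type) (s : seq I) (P : pred I) (F : I -> (nat -> nat) -> nat) :
  (forall i, dex (F i)) -> dex (fun v => \sum_(i <- s | P i) F i v).
Proof.
move=> dF; elim: s => [|i s [t tP]].
  by exists (TConst 0) => v; rewrite big_nil.
have [u uP] := dF i; exists (if P i then TAdd u t else t) => v.
by rewrite big_cons; case: (P i); rewrite /= -?uP -tP.
Qed.

(** A fresh existential variable for each subterm flattens the equation into the three basic
    shapes. *)
Lemma dio_teval t : dio (fun v => v 0 = teval t (fun i => v i.+1)).
Proof.
elim: t => [i|c|s IHs t IHt|s IHs t IHt] /=.
(* Equality of two variables is not a basic shape; it becomes a multiplication by 1. *)
- apply: (@dio_ext (fun v => exists x y, [/\ x = 1, v 0 * y = v i.+1 & x = y])).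
    move=> v; split=> [[x [y [-> e ey]]]|->]; first by rewrite -ey muln1 in e.
    by exists 1, 1; rewrite muln1.
  do 2 apply: dio_ex; apply: (@dio_ext (fun v =>
    v 1 = 1 /\ v 2 * v 0 = v i.+3 /\ v 0 = 1)).
    by move=> v; split=> [[e1 [e e2]]|[e1 e e2]]; do !split=> //; rewrite ?e1 ?e2 -?e2.
  apply: dio_and; first exact: dio_one.
  by apply: dio_and; [exact: dio_mulv|exact: dio_one].
- elim: c => [|c IHc].
    (* The equation x + x = x defines 0. *)
    by apply: dio_ext (dio_addv 0 0 0) => v; lia.
  apply: (@dio_ext (fun v => exists x y, x = c /\ y = 1 /\ x + y = v 0)).
    by move=> v; split=> [[x [y [-> [-> <-]]]]|->]; [lia|exists c, 1; lia].
  apply: dio_ex; apply: dio_ex; apply: dio_and; first exact: (dio_ren succn IHc).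
  by apply: dio_and; [exact: dio_one|exact: dio_addv].
- pose S t x v := x = teval t v.
  apply: (@dio_ext (fun v => exists x y, S s x (fun i => v i.+1) /\
    S t y (fun i => v i.+1) /\ x + y = v 0)).
    move=> v; split=> [[x [y [-> [-> <-]]]]//|->].
    by exists (teval s (fun i => v i.+1)), (teval t (fun i => v i.+1)).
  apply: dio_ex; apply: dio_ex; apply: dio_and.
    exact: (dio_ren (fun i => if i is j.+1 then j.+3 else 1) IHs).
  apply: dio_and; last exact: dio_addv.
  exact: (dio_ren (fun i => if i is j.+1 then j.+3 else 0) IHt).
- pose S t x v := x = teval t v.
  apply: (@dio_ext (fun v => exists x y, S s x (fun i => v i.+1) /\
    S t y (fun i => v i.+1) /\ x * y = v 0)).
    move=> v; split=> [[x [y [-> [-> <-]]]]//|->].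
    by exists (teval s (fun i => v i.+1)), (teval t (fun i => v i.+1)).
  apply: dio_ex; apply: dio_ex; apply: dio_and.
    exact: (dio_ren (fun i => if i is j.+1 then j.+3 else 1) IHs).
  apply: dio_and; last exact: dio_mulv.
  exact: (dio_ren (fun i => if i is j.+1 then j.+3 else 0) IHt).
Qed.

Lemma dio_eq a b : dex a -> dex b -> dio (fun v => a v = b v).
Proof.
case=> s sP [t tP].
apply: (@dio_ext (fun v => exists x, x = teval s v /\ x = teval t v)).
  by move=> v; rewrite sP tP; split=> [[x [-> ->]]|->]; last exists (teval t v).
by apply: dio_ex; apply: dio_and; apply: dio_teval.
Qed.

(** * Exponentiation and bitwise domination are Diophantine *)

Ltac dex_tac := cbv beta;
  first
  [ eassumption
  | apply dex_var
  | apply dex_const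
  | apply dex_add; dex_tac
  | apply dex_mul; dex_tac
  | apply dex_succ; dex_tac
  | apply dex_sum; intro; dex_tac
  | match goal with h : dex ?a |- dex (fun v => ?a (fun i => v (@?r i))) =>
      exact (@dex_ren r a h) end ].

Ltac dio_tac := cbv beta;
  first
  [ eassumption
  | apply dio_ex; dio_tac
  | apply dio_and; dio_tac
  | apply dio_eq; dex_tac
  | idtac ].

Lemma dio_le a b : dex a -> dex b -> dio (fun v => a v <= b v).
Proof.
move=> da db; apply: (@dio_ext (fun v => exists x, a v + x = b v)).
  by move=> v; split=> [[x <-]|]; [exact: leq_addr|exists (b v - a v); lia].
dio_tac.
Qed.

Lemma dio_lt a b : dex a -> dex b -> dio (fun v => a v < b v).
Proof. by move=> da db; apply: dio_le => //; apply: dex_succ. Qed.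

Lemma dio_mod a b c : dex a -> dex b -> dex c ->
  dio (fun v => a v = b v %[mod c v]).
Proof.
move=> da db dc.
apply: (@dio_ext (fun v => exists x y, a v + c v * x = b v + c v * y)).
  move=> v; split=> [[x [y e]]|e].
    by rewrite -(modnMDl x) -[RHS](modnMDl y) ![_ * c v]mulnC !(addnC (c v * _)) e.
  exists (b v %/ c v), (a v %/ c v).
  rewrite {1}(divn_eq (a v) (c v)) [in RHS](divn_eq (b v) (c v)) e; lia.
dio_tac.
Qed.

Ltac dio_arith := dio_tac; repeat
  first [ apply dio_le; dex_tac | apply dio_lt; dex_tac | apply dio_mod; dex_tac ].

Definition pellyn (a k : nat) : nat := `|pelly a k|%N.

(** The base is a third successor because [pelly_spec_sound] asks for a base above 2. *)
Lemma dio_pelly y a k : dex y -> dex a -> dex k ->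
  dio (fun v => y v = pellyn (a v).+3 (k v)).
Proof.
move=> dy da dk.
apply: (@dio_ext (fun v => exists t u s r e w x' y',
          pelly_spec (a v).+3 (k v) (y v) t u s r e w x' y')).
  move=> v; split.
    case=> t [u [s [r [e [w [x' [y' /pelly_spec_sound yE]]]]]]].
    by rewrite /pellyn -yE.
  move=> yE; apply: pelly_spec_complete => //; rewrite yE /pellyn.
  by have := @pell_ge0 (Posz (a v).+3) (k v); lia.
rewrite /pelly_spec.
apply: (@dio_ext (fun v => exists t u s r e w x' y',
  (t * t + u * u = 1 + (a v).+3 * (a v).+3 * u * u /\ 2 * y v < u /\ 2 * k v < u) /\
  (s * s + r * r = 1 + (a v).+3 * (a v).+3 * r * r /\ 0 < r /\ r = u * u * e) /\
  (1 < w /\ w = (a v).+3 %[mod s] /\ w = 1 %[mod u]) /\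
  (x' * x' + y' * y' = 1 + w * w * y' * y' /\
      y' = y v %[mod s] /\ y' = k v %[mod u]))).
  move=> v; split=> -[t [u [s [r [e [w [x' [y' H]]]]]]]];
  exists t, u, s, r, e, w, x', y'.
    by case: H => [[? [? ?]] [[? [? ?]] [[? [? ?]] [? [? ?]]]]].
  by case: H => [[? ? ?] [[? ? ?] [[? ? ?] [? ? ?]]]].
dio_arith.
Qed.

Section PellPow.
Import Order.TTheory GRing.Theory Num.Theory.
Local Open Scope ring_scope.

(** Modulo 2ab - b^2 - 1, b is a root of X^2 - 2aX + 1, the characteristic polynomial of both Pell
    sequences; hence b^n obeys their recurrence. *)
Lemma pell_pow (a b : int) n :
  (2 * a * b - b ^+ 2 - 1 %| pellx a n - pelly a n * (a - b) - b ^+ n)%Z.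
Proof.
elim: n => [|n /dvdzP[q IHn]]; first by rewrite /pellx /pelly /= !mul0r subr0 subrr.
have {}IHn : b ^+ n = pellx a n - pelly a n * (a - b) - q * (2 * a * b - b ^+ 2 - 1).
  by rewrite -IHn; ring.
apply/dvdzP; exists (pelly a n + b * q).
by rewrite pellxS pellyS (exprS b n) IHn; ring.
Qed.

Lemma pelly_ge_exp (a : int) n : 1 < a -> a ^+ n <= pelly a n.+1.
Proof.
move=> a1; elim: n => [|n IHn]; first by rewrite /pelly /= expr0; lia.
have [x0 _] := pell_ge0 n.+1 a1; rewrite pellyS exprS; nia.
Qed.

Lemma Posz_exp (a n : nat) : Posz (expn a n) = Posz a ^+ n.
Proof. by elim: n => // n IHn; rewrite expnS exprS PoszM IHn. Qed.

End PellPow.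

(** With b = q + 1, the Pell number [c] bounds b^n, so a base [a] above [c] makes the modulus [t] of
    [pell_pow] exceed b^n. The congruence then determines p < t. *)
Lemma pow_spec (p q n : nat) :
  p = q.+1 ^ n <-> exists c y x t,
    c = pellyn q.+3 n.+1 /\ y = pellyn (c + q).+3 n /\
    x * x + y * y = 1 + (c + q).+3 * (c + q).+3 * y * y /\
    t + q.+1 * q.+1 + 1 = 2 * (c + q).+3 * q.+1 /\
    p < t /\ x + y * q.+1 = (c + q).+3 * y + p %[mod t].
Proof.
set b := q.+1; pose c := pellyn q.+3 n.+1; set a := (c + q).+3.
have ltbc : b ^ n <= c.
  have := @pelly_ge_exp (Posz q.+3) n isT; rewrite -Posz_exp.
  have : b ^ n <= q.+3 ^ n by case: (n) => // m; rewrite leq_exp2r // /b; lia.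
  rewrite /c /pellyn; lia.
have a1 : 1 < a by [].
pose t := 2 * a * b - b * b - 1.
have tE : t + b * b + 1 = 2 * a * b by rewrite /t /a /b; nia.
have ltbt : b ^ n < t by rewrite /t /a /b in ltbc *; nia.
pose y := pellyn a n; pose x := `|pellx a n|%N.
have [xE yE] : Posz x = pellx a n /\ Posz y = pelly a n.
  by have := @pell_ge0 (Posz a) n; rewrite /x /y /pellyn; lia.
have key : x + y * b = a * y + b ^ n %[mod t].
  apply/eqn_mod_dvdz; have := pell_pow a b n.
  have -> : (2 * Posz a * Posz b - Posz b ^+ 2 - 1 = Posz t)%R by rewrite GRing.expr2; lia.
  by rewrite -xE -yE -Posz_exp; congr (_ %| _)%Z; lia.
split=> [->|[c' [y' [x' [t' [-> [-> [exy [et [ltpt e]]]]]]]]]].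
  exists c, y, x, t; do !split=> //.
  by apply/(pell_eq_nat _ _ a1); exists n.
rewrite -/b -/c -/a in exy et ltpt e.
have tt' : t' = t by apply: (@addIn (b * b)); apply: (@addIn 1); rewrite et tE.
(* The Pell equation determines x from y. *)
have xx' : x' = x.
  have exy0 := (pell_eq_nat x y a1).2 (ex_intro _ n (conj xE yE)).
  apply/eqP; rewrite -(@eqn_exp2r _ _ 2) // -!mulnn.
  by rewrite -(eqn_add2r (y * y)) exy0 exy.
rewrite xx' tt' key in e; rewrite tt' in ltpt.
by move/eqP: e; rewrite eqn_modDl !modn_small // => /eqP.
Qed.

Lemma dio_pow p q n : dex p -> dex q -> dex n ->
  dio (fun v => p v = (q v).+1 ^ n v).
Proof.
move=> dp dq dn; apply: (@dio_ext (fun v => exists c y x t,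
    c = pellyn (q v).+3 (n v).+1 /\ y = pellyn (c + q v).+3 (n v) /\
    x * x + y * y = 1 + (c + q v).+3 * (c + q v).+3 * y * y /\
    t + (q v).+1 * (q v).+1 + 1 = 2 * (c + q v).+3 * (q v).+1 /\
    p v < t /\ x + y * (q v).+1 = (c + q v).+3 * y + p v %[mod t])).
  by move=> v; rewrite pow_spec.
dio_arith.
- apply: (@dio_pelly (fun v => v 3) (fun v => q (fun i => v i.+4))
                     (fun v => (n (fun i => v i.+4)).+1)); dex_tac.
- apply: (@dio_pelly (fun v => v 2) (fun v => v 3 + q (fun i => v i.+4))
                     (fun v => n (fun i => v i.+4))); dex_tac.
Qed.

(** * Parity of binomial coefficients and the bitwise order *)

Lemma odd_binD n k : odd 'C(n.*2, k.*2) = odd 'C(n, k) /\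
  odd 'C(n.*2, k.*2.+1) = false.
Proof.
elim: n k => [|n IHn] k; first by case: k.
have [e1 e2] := IHn k; rewrite doubleS.
case: k e1 e2 => [|k] e1 e2; first by rewrite !bin0 !bin1 /= odd_double.
have [e3 e4] := IHn k.
rewrite doubleS !binS !oddD -doubleS e1 e2 e3 e4 !addbF !addFb addbb.
by split.
Qed.

Definition mask (a b : nat) : bool := odd 'C(b, a).

(** One binary digit of Lucas's theorem modulo 2: [mask a b] says that each binary digit of [a] is
    at most that of [b]. *)
Lemma mask_double a b (i j : bool) :
  mask (i + a.*2) (j + b.*2) = (i ==> j) && mask a b.
Proof.
rewrite /mask; have [e0 e1] := odd_binD b a.
case: i; case: j; rewrite ?add0n ?add1n ?e0 ?e1 //=.
  by rewrite binS oddD e0 e1.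
case: a e0 e1 => [|a] e0 e1; first by rewrite !bin0.
by have [e2 e3] := odd_binD b a; rewrite doubleS binS oddD -doubleS e0 e3 addbF.
Qed.

Lemma mask_le a b : mask a b -> a <= b.
Proof. by rewrite /mask; case: leqP => // /bin_small->. Qed.

Lemma mask_block c a0 b0 a b : a0 < 2 ^ c -> b0 < 2 ^ c ->
  mask (a0 + 2 ^ c * a) (b0 + 2 ^ c * b) = mask a0 b0 && mask a b.
Proof.
elim: c a0 b0 => [|c IHc] a0 b0.
  by rewrite !ltnS !leqn0 => /eqP-> /eqP->; rewrite !mul1n.
have half x y : x + 2 ^ c.+1 * y = odd x + (x./2 + 2 ^ c * y).*2.
  by rewrite doubleD addnA odd_double_half expnS -mul2n mulnA.
have lthalf x : x < 2 ^ c.+1 -> x./2 < 2 ^ c.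
  by rewrite expnS mul2n ltn_half_double.
move=> /lthalf lta /lthalf ltb; rewrite !half mask_double IHc //.
by rewrite andbA -mask_double !odd_double_half.
Qed.

Lemma mask_ones a c : a < 2 ^ c -> mask a (2 ^ c - 1).
Proof.
elim: c a => [|c IHc] a; first by rewrite ltnS leqn0 => /eqP->.
move=> lta; rewrite -[a]odd_double_half.
have -> : 2 ^ c.+1 - 1 = true + (2 ^ c - 1).*2.
  by rewrite expnS mul2n -muln2; have := expn_gt0 2 c; lia.
by rewrite mask_double implybT IHc // ltn_half_double -mul2n -expnS.
Qed.

(** * Expansions in base Q *)

Definition num (Q : nat) (d : nat -> nat) (s : nat) := \sum_(t < s) d t * Q ^ t.

Lemma num_recr Q d s : num Q d s.+1 = num Q d s + d s * Q ^ s.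
Proof. by rewrite /num big_ord_recr. Qed.

Lemma num_recl Q d s : num Q d s.+1 = d 0 + Q * num Q (fun t => d t.+1) s.
Proof.
rewrite /num big_ord_recl muln1 big_distrr /=; congr addn.
by apply: eq_bigr => i _; rewrite expnS mulnCA.
Qed.

Lemma num_cat Q d k s :
  num Q d (k + s) = num Q d k + Q ^ k * num Q (fun t => d (k + t)) s.
Proof.
elim: s => [|s IHs]; first by rewrite addn0 /num big_ord0 muln0 addn0.
by rewrite addnS !num_recr IHs expnD; lia.
Qed.

Lemma num_lt Q d s : (forall t, t < s -> d t < Q) -> num Q d s < Q ^ s.
Proof.
elim: s => [|s IHs] ltd; first by rewrite /num big_ord0.
rewrite num_recr expnS.
apply: (@leq_trans (Q ^ s + d s * Q ^ s)).
  by rewrite ltn_add2r IHs // => t lt; apply: ltd; lia.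
by rewrite -mulSn leq_mul2r ltd ?orbT.
Qed.

Lemma eq_num Q d e s : (forall t, t < s -> d t = e t) -> num Q d s = num Q e s.
Proof. by move=> de; apply: eq_bigr => i _; rewrite de. Qed.

Lemma num_inj Q d e s : (forall t, t < s -> d t < Q) -> (forall t, t < s -> e t < Q) ->
  num Q d s = num Q e s -> forall t, t < s -> d t = e t.
Proof.
elim: s => // s IHs ltd lte; rewrite !num_recr => eqn.
have ltds : num Q d s < Q ^ s by apply: num_lt => t lt; apply: ltd; lia.
have ltes : num Q e s < Q ^ s by apply: num_lt => t lt; apply: lte; lia.
have eqs : d s = e s.
  have := congr1 (fun x => x %/ Q ^ s) eqn.
  by rewrite !(addnC (num _ _ _)) !divnMDl ?(leq_ltn_trans _ ltds) // !divn_small // !addn0.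
move=> t; rewrite ltnS leq_eqVlt => /orP[/eqP-> //|]; apply: IHs => [u|u|].
- by move=> lt; apply: ltd; lia.
- by move=> lt; apply: lte; lia.
by move: eqn; rewrite eqs => /addIn.
Qed.

Lemma num_digits Q X s : 0 < Q -> X < Q ^ s -> exists d,
  (forall t, d t < Q) /\ X = num Q d s.
Proof.
move=> Q0; elim: s X => [|s IHs] X ltX.
  exists (fun=> 0); split=> //; rewrite /num big_ord0.
  by move: ltX; rewrite ltnS leqn0 => /eqP.
have [|d [ltd dE]] := IHs (X %/ Q); first by rewrite ltn_divLR // -expnSr.
exists (fun t => if t is t'.+1 then d t' else X %% Q); split.
  by case=> [|t]; rewrite ?ltn_mod.
by rewrite num_recl -dE {1}(divn_eq X Q); lia.
Qed.

Lemma bin_le_exp n k : 'C(n, k) <= 2 ^ n.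
Proof.
elim: n k => [|n IHn] [|k] //; first by rewrite bin0 expn_gt0.
by rewrite binS expnS mul2n -addnn leq_add.
Qed.

(** All C(n, i) are at most 2^n < u, so they are the base u digits of (u + 1)^n. The witnesses cut
    out digit k: [h] is the part above it, [l] the part below, and 2w + 1 says that it is odd. *)
Lemma mask_spec k n : mask k n <-> exists u p r h w l,
  u = 2 ^ n.+1 /\ p = u.+1 ^ n /\ r = u ^ k /\
  p = (h * u + (2 * w + 1)) * r + l /\ l < r /\ 2 * w + 1 < u.
Proof.
pose u := 2 ^ n.+1; pose d i := 'C(n, i).
have ltd i : d i < u by rewrite (leq_ltn_trans (bin_le_exp n i)) // ltn_exp2l.
(* Padding with zero digits ensures that position k exists even when k > n. *)
have pE : u.+1 ^ n = num u d (k + n.+1).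
  rewrite -add1n expnDn addnC num_cat [X in _ = _ + _ * X]big1 ?muln0 ?addn0.
    by apply: eq_bigr => i _; rewrite exp1n mul1n.
  by move=> i _; rewrite /d bin_small // leq_addr.
rewrite num_cat num_recl addn0 in pE.
set h := num u _ n in pE; set l := num u d k in pE.
have ltl : l < u ^ k by apply: num_lt.
split=> [mkn|[u' [p [r [h' [w [l' [-> [-> [-> [eqp [ltl' ltw]]]]]]]]]]]].
  have dE : 2 * (d k)./2 + 1 = d k.
    by rewrite -[RHS]odd_double_half /d; move: mkn; rewrite /mask => ->; lia.
  exists u, (u.+1 ^ n), (u ^ k), h, (d k)./2, l; rewrite dE; do !split=> //.
  by rewrite pE; lia.
rewrite /mask; have := congr1 (fun x => x %/ u ^ k %% u) eqp.
rewrite -/u pE divnMDl ?expn_gt0 // [l' %/ _]divn_small // addn0 modnMDl.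
rewrite (modn_small ltw) addnC mulnC divnMDl ?expn_gt0 // divn_small // addn0.
by rewrite mulnC addnC modnMDl modn_small // -/(d k) => ->; rewrite oddD oddM.
Qed.

Lemma dio_mask a b : dex a -> dex b -> dio (fun v => mask (a v) (b v)).
Proof.
move=> da db; apply: (@dio_ext (fun v => exists u p r h w l,
  (exists z, u = z.+1 /\ r = z.+1 ^ a v) /\ u = 2 ^ (b v).+1 /\ p = u.+1 ^ b v /\
  p = (h * u + (2 * w + 1)) * r + l /\ l < r /\ 2 * w + 1 < u)).
  move=> v; rewrite mask_spec; split=> -[u [p [r [h [w [l]]]]]].
    case=> [[z [-> ->]]] [uE [-> H]].
    by exists z.+1, (z.+2 ^ b v), (z.+1 ^ a v), h, w, l.
  case=> uE [pE [rE H]]; exists u, p, r, h, w, l; split=> //.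
  by exists u.-1; rewrite prednK // uE expn_gt0.
dio_arith; apply dio_pow; dex_tac.
Qed.

(** * Runs of register machines are Diophantine *)

(* An edge is (source, target, register, kind), the kind being Some true for an
   increment, Some false for a successful decrement, None for a zero test. *)
Definition edge := (nat * nat * nat * option bool)%type.
Definition esrc (e : edge) := e.1.1.1.
Definition etgt (e : edge) := e.1.1.2.
Definition ereg (e : edge) := e.1.2.
Definition ekind (e : edge) := e.2.

Definition edges_at (i : nat) (ins : instr) : seq edge :=
  match ins with
  | Inc r j => [:: (i, j, r, Some true)]
  | Dec r jnz jz => [:: (i, jnz, r, Some false); (i, jz, r, None)]
  end.

Definition edges (P : program) : seq edge :=
  flatten [seq edges_at i (nth (Inc 0 0) P i) | i <- iota 0 (size P)].

Definition enabled (c : config) (e : edge) : bool :=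
  (esrc e == c.1) &&
  match ekind e with
  | Some true => true
  | Some false => 0 < c.2 (ereg e)
  | None => c.2 (ereg e) == 0
  end.

Definition act (e : edge) (r x : nat) : nat :=
  x + ((ekind e == Some true) && (ereg e == r))
    - ((ekind e == Some false) && (ereg e == r)).

Lemma step_edge P c e : e \in edges P -> enabled c e ->
  (step P c).1 = etgt e /\ forall r, (step P c).2 r = act e r (c.2 r).
Proof.
case: c => pc R /flattenP[l /mapP[i]]; rewrite mem_iota add0n => /andP[_ ltiP] ->.
rewrite /enabled /act /=.
case E: (nth _ _ _) => [r j|r jnz jz] /=.
  rewrite inE => /eqP-> /=; rewrite /esrc /= => /andP[/eqP<- _].
  rewrite (nth_map (Inc 0 0)) // E; split=> // r'.
  by rewrite /setreg /ereg /= subn0 eq_sym; case: eqP => [->|]; rewrite ?addn1 ?addn0.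
rewrite !inE => /orP[] /eqP-> /=; rewrite /esrc /ereg /= => /andP[/eqP<-].
  rewrite (nth_map (Inc 0 0)) // E; case Rr: (R r) => [//|k] _; split=> // r'.
  rewrite /setreg /= addn0 eq_sym; case: eqP => [<-|]; last by rewrite subn0.
  by rewrite Rr subn1.
by move=> /eqP Rr; rewrite (nth_map (Inc 0 0)) // E Rr; split=> // r'; rewrite addn0 subn0.
Qed.

Lemma has_enabled P c : ~~ halted P c -> has (enabled c) (edges P).
Proof.
rewrite /halted -ltnNge => ltP; apply/hasP.
have [e eat en] : exists2 e, e \in edges_at c.1 (nth (Inc 0 0) P c.1) & enabled c e.
  case: (nth _ _ _) => [r j|r jnz jz].
    by exists (c.1, j, r, Some true); rewrite ?mem_head // /enabled eqxx.
  case E: (c.2 r) => [|k].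
    by exists (c.1, jz, r, None); rewrite ?inE ?eqxx ?orbT // /enabled /ereg /= E !eqxx.
  by exists (c.1, jnz, r, Some false); rewrite ?mem_head // /enabled /ereg /= E eqxx.
exists e => //; apply/flattenP; exists (edges_at c.1 (nth (Inc 0 0) P c.1)) => //.
by apply: map_f; rewrite mem_iota.
Qed.

(** One bound for addresses, registers and the number of edges, so that a single inequality makes
    the base large enough. *)
Lemma edges_bound (T : seq edge) : exists2 M, size T < M &
  forall e, e \in T -> [/\ esrc e < M, etgt e < M & ereg e < M].
Proof.
elim: T => [|e T [M ltM HM]]; first by exists 1.
exists (M + (esrc e + etgt e + ereg e)).+1; first by rewrite /= ltnS; lia.
move=> e'; rewrite inE => /orP[/eqP->|/HM[? ? ?]]; split; lia.
Qed.

Lemma mask_num c s a b : (forall t, t < s -> a t < 2 ^ c) ->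
  (forall t, t < s -> b t < 2 ^ c) ->
  mask (num (2 ^ c) a s) (num (2 ^ c) b s) <-> forall t, t < s -> mask (a t) (b t).
Proof.
elim: s a b => [|s IHs] a b lta ltb; first by rewrite /num !big_ord0.
rewrite !num_recl mask_block ?lta ?ltb //; split=> [/andP[m0 /IHs ms]|m].
  by case=> // t; apply: ms => u; [apply: (lta u.+1)|apply: (ltb u.+1)].
rewrite m //; apply/IHs => t lt; [exact: (lta t.+1)|exact: (ltb t.+1)|exact: (m t.+1)].
Qed.

Lemma num_lin Q N (c : nat -> nat) (e : nat -> nat -> nat) s :
  \sum_(n < N) c n * num Q (e n) s = num Q (fun t => \sum_(n < N) c n * e n t) s.
Proof.
rewrite /num; under eq_bigr => n _ do rewrite big_distrr /=.
rewrite exchange_big /=; apply: eq_bigr => t _; rewrite big_distrl /=.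
by apply: eq_bigr => n _; rewrite mulnA.
Qed.

Lemma num_add Q a b s : num Q a s + num Q b s = num Q (fun t => a t + b t) s.
Proof. by rewrite /num -big_split; apply: eq_bigr => t _; rewrite mulnDl. Qed.

Lemma num_mul Q c a s : c * num Q a s = num Q (fun t => c * a t) s.
Proof. by rewrite /num big_distrr /=; apply: eq_bigr => t _; rewrite mulnA. Qed.

(** The geometric series, written without subtraction. *)
Lemma num_ones Q s : 1 < Q -> forall I, I * Q + 1 = I + Q ^ s <-> I = num Q (fun=> 1) s.
Proof.
move=> Q1 I; have eQ : num Q (fun=> 1) s * Q + 1 = num Q (fun=> 1) s + Q ^ s.
  by elim: s => [|s IHs]; rewrite ?num_recr ?expnS /num ?big_ord0 //; rewrite /num in IHs; lia.
split=> [eI|->] //; move: eI eQ; move: (num _ _ _) => J; nia.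
Qed.

Definition trace_of (x : nat) (a : nat -> nat) (t : nat) := if t is t'.+1 then a t' else x.

(* Digitwise reading of [x + Q * a = b + y * Q^s]: the sequence b is a delayed by
   one time unit, starting at x and ending at y. *)
Lemma num_shift Q x y a b s : x < Q ->
  (forall t, t < s -> a t < Q) -> (forall t, t < s -> b t < Q) ->
  x + Q * num Q a s = num Q b s + y * Q ^ s <->
  (forall t, t < s -> b t = trace_of x a t) /\ y = trace_of x a s.
Proof.
move=> ltx lta ltb; have -> : x + Q * num Q a s = num Q (trace_of x a) s.+1.
  by rewrite num_recl.
rewrite num_recr; split=> [e|[bz ->]]; last by rewrite (eq_num Q bz).
have ltz t : t < s -> trace_of x a t < Q.
  by case: t => //= t lt; apply: lta; apply: ltnW.
have Q0 : 0 < Q ^ s by rewrite expn_gt0; case: Q ltx {e lta ltb ltz}.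
have ey : y = trace_of x a s.
  have := congr1 (fun x => x %/ Q ^ s) e.
  by rewrite !(addnC (num _ _ _)) !divnMDl // !divn_small ?num_lt // !addn0.
by split=> //; apply: (@num_inj Q) => //; move: e; rewrite ey => /addIn->.
Qed.

Lemma sum_delta N (c e : nat -> nat) n : n < N -> e n = 1 ->
  (forall m, m < N -> m != n -> e m = 0) -> \sum_(m < N) c m * e m = c n.
Proof.
move=> ltn en em; rewrite (bigD1 (Ordinal ltn)) //= en muln1 big1 ?addn0 // => m nm.
by rewrite em ?muln0 //; apply: contraNneq nm => e0; apply/eqP/val_inj.
Qed.

(** Applied to the edge digits of one time, this singles out the edge taken then. *)
Lemma sum_eq1 N (e : nat -> nat) : \sum_(m < N) e m = 1 ->
  exists2 n, n < N & e n = 1 /\ forall m, m < N -> m != n -> e m = 0.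
Proof.
elim: N => [|N IHN]; rewrite ?big_ord0 // big_ord_recr /=.
case eN: (e N) => [|[|k]]; last by lia.
  rewrite addn0 => /IHN[n ltn [en em]]; exists n; first exact: ltnW.
  split=> // m; rewrite ltnS leq_eqVlt => /orP[/eqP-> //|]; exact: em.
move/(@addIn 1 _ 0) => e0; exists N => //; split=> // m; rewrite ltnS leq_eqVlt => /orP[->//|ltm] _.
by apply/eqP; rewrite -leqn0 -e0 (bigD1 (Ordinal ltm)) //= leq_addr.
Qed.

Lemma run_halted P t n : halted P (run P t n) -> forall u, run P (t + u) n = run P t n.
Proof.
move=> ht; elim=> [|u IHu]; rewrite ?addn0 // addnS.
rewrite -[run P _.+1 n]/(step P (run P (t + u) n)) IHu.
move: ht; rewrite /halted /step; case: (run P t n) => pc R /= lepc.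
by rewrite nth_default // size_map.
Qed.

Definition halts_zero (P : program) (n : nat) : Prop :=
  exists k, halted P (run P k n) /\ (run P k n).2 0 = 0.

Section Simulation.
Variables (P : program) (M : nat).
Let T := edges P.
Let N := size T.
Let e0 : edge := (0, 0, 0, None).
Let ed n := nth e0 T n.
Hypothesis ltNM : N < M.
Hypothesis ltM : forall e, e \in T -> [/\ esrc e < M, etgt e < M & ereg e < M].

Definition cinc (r n : nat) : nat := (ekind (ed n) == Some true) && (ereg (ed n) == r).
Definition cdec (r n : nat) : nat := (ekind (ed n) == Some false) && (ereg (ed n) == r).

(* E n codes the times at which edge n is taken, Rg r the values of register r, in
   base Q = 2 (B + 1) with digits at most B; A r codes the shifted values, F r is the
   final value and D n witnesses that a decremented register was positive. *)
Definition halting_system (x c s B S I pcf : nat) (E Rg A D F : nat -> nat) : Prop :=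
  let Q := (2 * B + 1).+1 in
  B.+1 = 2 ^ c /\ S = (2 * B + 1).+1 ^ s /\ I * Q + 1 = I + S /\ x + M < B.+1 /\
  size P <= pcf /\ F 0 = 0 /\ \sum_(n < N) E n = I /\
  (forall n, n < N -> mask (E n) I) /\
  (forall r, r < M -> mask (Rg r) (B * I)) /\
  (forall n, n < N -> match ekind (ed n) with
     | Some true => True
     | Some false => Rg (ereg (ed n)) = D n + E n /\ mask (D n) (B * I)
     | None => mask (Rg (ereg (ed n))) (B * \sum_(m < N) ((m : nat) != n) * E m)
     end) /\
  Q * (\sum_(n < N) etgt (ed n) * E n) = \sum_(n < N) esrc (ed n) * E n + pcf * S /\
  (forall r, r < M -> (if r == 0 then x else 0) + Q * A r = Rg r + F r * S /\
     Rg r + \sum_(n < N) cinc r n * E n = A r + \sum_(n < N) cdec r n * E n).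

Let in_edges n : n < N -> ed n \in T.
Proof. exact: mem_nth. Qed.

Lemma run_S k x : run P k.+1 x = step P (run P k x).
Proof. by []. Qed.

(** Digits are small enough for the sums to have no carries, so the equations hold digit by digit.
    The sum [I] makes exactly one edge active at each time, and induction on time identifies the
    digits with the run. *)
Lemma halting_sound x c s B S I pcf E Rg A D F :
  halting_system x c s B S I pcf E Rg A D F -> halts_zero P x.
Proof.
rewrite /halting_system => -[Bc [SE [IE [ltxB [lepc [F0 [sumE]]]]]]].
case=> [mE [mR [mK [pcE regE]]]].
have QE : (2 * B + 1).+1 = 2 ^ c.+1 by rewrite expnS -Bc; lia.
set Q := (2 * B + 1).+1 in QE SE IE pcE regE.
have Q1 : 1 < Q by rewrite /Q; lia.
have Q0 : 0 < Q by [].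
have {}IE : I = num Q (fun=> 1) s by apply/(num_ones s Q1); rewrite -SE.
have ltI : I < Q ^ s by rewrite IE; apply: num_lt.
have BI : B * I = num Q (fun=> B) s.
  by rewrite IE num_mul; apply: eq_num => t _; rewrite muln1.
have ltB : B < Q by rewrite /Q; lia.
have ltBI : B * I < Q ^ s by rewrite BI; apply: num_lt.
have masknum a b : (forall t, t < s -> a t < Q) -> (forall t, t < s -> b t < Q) ->
    mask (num Q a s) (num Q b s) <-> forall t, t < s -> mask (a t) (b t).
  by rewrite QE; apply: mask_num.
(* A number masked by the constant digit [b] has all digits at most [b]. *)
have dig (X : nat -> nat) L b : b < Q -> num Q (fun=> b) s < Q ^ s ->
    (forall n, n < L -> mask (X n) (num Q (fun=> b) s)) ->
    exists d, (forall n t, n < L -> t < s -> d n t <= b) /\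
      forall n, n < L -> X n = num Q (d n) s.
  move=> ltb ltnb; elim: L => [|L IHL] mX; first by exists (fun _ _ => 0).
  have [n lt|d [led dE]] := IHL; first by apply: mX; apply: ltnW.
  have mXL := mX L (ltnSn L).
  have [f [ltf fE]] := num_digits Q0 (leq_ltn_trans (mask_le mXL) ltnb).
  exists (fun n => if n == L then f else d n); split=> [n t|n].
    rewrite ltnS leq_eqVlt; case: eqP => //= [_ _ lts|_]; last by exact: led.
    by rewrite fE in mXL; apply: mask_le; apply: (masknum _ _ _ _).1 mXL _ lts.
  by rewrite ltnS leq_eqVlt; case: eqP => //= [->|_ /dE].
have [|//|e [le_e eE]] := @dig E N 1 Q1; rewrite -?IE //.
have [|//|rr [le_r rE]] := @dig Rg M B ltB; rewrite -?BI //.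
have E_lin (cf : nat -> nat) : \sum_(n < N) cf n * E n =
    num Q (fun t => \sum_(n < N) cf n * e n t) s.
  by rewrite -num_lin; apply: eq_bigr => n _; rewrite eE.
have lin_le (cf : nat -> nat) t : t < s -> (forall n, n < N -> cf n <= 1) ->
    \sum_(n < N) cf n * e n t <= N.
  move=> lts cf1; rewrite -[X in _ <= X]card_ord -sum1_card; apply: leq_sum => n _.
  by rewrite -[1]muln1 leq_mul ?cf1 ?le_e.
have ltNB : N < B by lia.
have active t : t < s -> exists2 n, n < N & e n t = 1 /\
    forall m, m < N -> m != n -> e m t = 0.
  move=> lts; apply: (@sum_eq1 N (e^~ t)).
  move: t lts; apply: (@num_inj Q).
  - move=> t lts; apply: leq_ltn_trans (_ : N < Q); last by lia.
    have := lin_le (fun=> 1) t lts (fun _ _ => isT).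
    by congr (_ <= _); apply: eq_bigr => n _; rewrite mul1n.
  - by [].
  rewrite -IE -sumE; have := E_lin (fun=> 1).
  under eq_bigr do rewrite mul1n; move=> ->.
  by apply: eq_num => t _; apply: eq_bigr => n _; rewrite mul1n.
have lin_eq (cf : nat -> nat) t n : n < N -> e n t = 1 ->
    (forall m, m < N -> m != n -> e m t = 0) -> \sum_(m < N) cf m * e m t = cf n.
  by move=> ltn; apply: (@sum_delta N cf (e^~ t)).
pose tg t := \sum_(n < N) etgt (ed n) * e n t.
pose sr t := \sum_(n < N) esrc (ed n) * e n t.
have ltMQ : M < Q by lia.
have [srE pcfE] : (forall t, t < s -> sr t = trace_of 0 tg t) /\ pcf = trace_of 0 tg s.
  apply/(@num_shift Q) => //.
  - move=> t /active[n ltn [en em]]; rewrite /tg (lin_eq (fun n => etgt (ed n)) t n) //.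
    by have [_ lt _] := ltM (in_edges ltn); apply: ltn_trans ltMQ.
  - move=> t /active[n ltn [en em]]; rewrite /sr (lin_eq (fun n => esrc (ed n)) t n) //.
    by have [lt _ _] := ltM (in_edges ltn); apply: ltn_trans ltMQ.
  by rewrite add0n -(E_lin (fun n => etgt (ed n))) -(E_lin (fun n => esrc (ed n))) -SE.
(* Digitwise, the register is the sum of [D n] and the edge digit 1. *)
have dec_pos t n : t < s -> n < N -> e n t = 1 -> ekind (ed n) = Some false ->
    0 < rr (ereg (ed n)) t.
  move=> lts ltn en kn; have := mK n ltn; rewrite kn => -[RE mD].
  have [_ _ ltr] := ltM (in_edges ltn).
  have [|//|d [le_d dE]] := @dig (fun=> D n) 1 B ltB; rewrite -?BI //.
  have := dE 0 isT; rewrite /= => DE.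
  rewrite rE // DE (eE n) // num_add in RE.
  have -> : rr (ereg (ed n)) t = d 0 t + e n t; last by rewrite en addn1.
  move: t lts {en}; apply: (@num_inj Q) => // t lts.
    by apply: leq_ltn_trans ltB; apply: le_r.
  by apply: leq_ltn_trans (leq_add (le_d 0 t isT lts) (le_e n t ltn lts)) _; lia.
(* The masking number has digit 0 when edge [n] is active and digit B at other times, so it
   constrains the register only when the zero test is passed. *)
have zero_reg t n : t < s -> n < N -> e n t = 1 -> ekind (ed n) = None ->
    (forall m, m < N -> m != n -> e m t = 0) -> rr (ereg (ed n)) t = 0.
  move=> lts ltn en kn em; have := mK n ltn; rewrite kn.
  have [_ _ ltr] := ltM (in_edges ltn).
  rewrite (E_lin (fun m => m != n)) num_mul rE // masknum.
  - move=> /(_ t lts); rewrite (lin_eq (fun m => m != n) t n) // eqxx muln0.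
    by move/mask_le; rewrite leqn0 => /eqP.
  - by move=> u ltu; apply: leq_ltn_trans ltB; apply: le_r.
  move=> u /active[k ltk [ek em']]; rewrite (lin_eq (fun m => m != n) u k) //.
  by apply: leq_ltn_trans ltB; rewrite -[X in _ <= X]muln1 leq_mul ?leq_b1.
pose nx r t := rr r t + \sum_(n < N) cinc r n * e n t - \sum_(n < N) cdec r n * e n t.
have dec_le r t : t < s -> r < M -> \sum_(n < N) cdec r n * e n t <= rr r t.
  move=> lts ltr; have [n ltn [en em]] := active t lts; rewrite (lin_eq (cdec r) t n) //.
  rewrite /cdec; case: eqP => //= kn; case: eqP => //= <-; exact: dec_pos.
have regE2 r : r < M -> (forall t, t < s ->
    rr r t = trace_of (if r == 0 then x else 0) (nx r) t) /\
    F r = trace_of (if r == 0 then x else 0) (nx r) s.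
  move=> ltr; have [e1 e2] := regE r ltr.
  apply/(@num_shift Q) => //.
  - by case: eqP => // _; lia.
  - move=> t lts; apply: leq_ltn_trans (leq_subr _ _) _.
    apply: leq_ltn_trans (leq_add (le_r r t ltr lts) (_ : _ <= 1)) _; last by lia.
    have [n ltn [en em]] := active t lts; rewrite (lin_eq (cinc r) t n) //.
    exact: leq_b1.
  - by move=> t lts; apply: leq_ltn_trans ltB; apply: le_r.
  rewrite -SE -rE // -e1; congr (_ + _ * _).
  have : num Q (nx r) s + \sum_(n < N) cdec r n * E n = A r + \sum_(n < N) cdec r n * E n.
    rewrite -e2 rE // !E_lin !num_add; apply: eq_num => t lts.
    by rewrite /nx subnK // (leq_trans (dec_le r t lts ltr)) ?leq_addr.
  by move/addIn.
have inv t : t <= s -> (run P t x).1 = trace_of 0 tg t /\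
    forall r, r < M -> (run P t x).2 r = trace_of (if r == 0 then x else 0) (nx r) t.
  elim: t => [|t IHt] lts //; have [IH1 IH2] := IHt (ltnW lts).
  have [n ltn [en em]] := active t lts.
  have [_ _ ltr] := ltM (in_edges ltn).
  have rz r : r < M -> (run P t x).2 r = rr r t.
    by move=> ltr'; rewrite IH2 // (regE2 r ltr').1.
  have en_n : enabled (run P t x) (ed n).
    rewrite /enabled IH1 -srE // /sr (lin_eq (fun n => esrc (ed n)) t n) // eqxx /= rz //.
    case kn: (ekind (ed n)) => [[]|] //; first exact: dec_pos.
    by rewrite zero_reg.
  have [s1 s2] := step_edge (in_edges ltn) en_n; rewrite run_S.
  split; first by rewrite s1 /= /tg (lin_eq (fun n => etgt (ed n)) t n).
  move=> r ltr'; rewrite s2 /act /= /nx rz //.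
  by rewrite (lin_eq (cinc r) t n) // (lin_eq (cdec r) t n).
have [i1 i2] := inv s (leqnn s); exists s; split.
  by rewrite /halted i1 -pcfE.
have M0 : 0 < M by lia.
by rewrite i2 // -(regE2 0 M0).2.
Qed.

Lemma halting_complete x : halts_zero P x ->
  exists c s B S I pcf E Rg A D F, halting_system x c s B S I pcf E Rg A D F.
Proof.
case=> k [hk zk].
(* Taking the first halting time guarantees an enabled edge at every earlier time. *)
have [s [hs zs Nh]] : exists s, [/\ halted P (run P s x), (run P s x).2 0 = 0 &
    forall t, t < s -> ~~ halted P (run P t x)].
  case: (ex_minnP (ex_intro (fun t => halted P (run P t x)) k hk)) => s hs min.
  exists s; split=> //; first by rewrite -(run_halted hs (k - s)) subnKC ?min.
  by move=> t lts; apply: contraL lts => /min; rewrite -leqNgt.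
pose st t := run P t x.
pose en t := find (enabled (st t)) T.
have hasT t : t < s -> has (enabled (st t)) T by move=> /Nh; apply: has_enabled.
have en_lt t : t < s -> en t < N by move=> /hasT; rewrite has_find.
have en_on t : t < s -> enabled (st t) (ed (en t)) by move=> /hasT; apply: nth_find.
have stS t : t < s -> (st t.+1).1 = etgt (ed (en t)) /\
    forall r, (st t.+1).2 r = act (ed (en t)) r ((st t).2 r).
  move=> lts; rewrite /st run_S.
  by apply: step_edge (en_on t lts); apply/in_edges/en_lt.
pose e n t : nat := n == en t.
pose rr r t := (st t).2 r.
(* A number above every value to be coded; B = 2^c - 1 is then at least [c]. *)
pose c := x + M + \sum_(t < s) \sum_(r < M) rr r t + 1.
pose B := 2 ^ c - 1; have Bc : B.+1 = 2 ^ c by rewrite /B; have := expn_gt0 2 c; lia.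
pose Q := (2 * B + 1).+1.
have QE : Q = 2 ^ c.+1 by rewrite expnS -Bc /Q; lia.
have ltcB : c <= B by rewrite -ltnS Bc ltn_expl.
have Q1 : 1 < Q by rewrite /Q; lia.
have ltBQ : B < Q by rewrite /Q; lia.
have rrB r t : r < M -> t < s -> rr r t <= B.
  move=> ltr lts; apply: leq_trans ltcB; rewrite /c.
  rewrite (bigD1 (Ordinal lts)) //= (bigD1 (Ordinal ltr)) //=; lia.
have e1 n t : e n t <= 1 by apply: leq_b1.
have lin_eq (cf : nat -> nat) t : t < s -> \sum_(n < N) cf n * e n t = cf (en t).
  move=> lts; apply: (@sum_delta N cf (e^~ t)); rewrite ?en_lt // /e ?eqxx //.
  by move=> m _ /negbTE->.
pose I := num Q (fun=> 1) s.
pose E n := num Q (e n) s.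
pose Rg r := num Q (rr r) s.
have E_lin (cf : nat -> nat) : \sum_(n < N) cf n * E n = num Q (fun t => cf (en t)) s.
  by rewrite num_lin; apply: eq_num => t lts; rewrite lin_eq.
have BI : B * I = num Q (fun=> B) s.
  by rewrite num_mul; apply: eq_num => t _; rewrite muln1.
have masknum a b : (forall t, t < s -> a t < Q) -> (forall t, t < s -> b t < Q) ->
    (forall t, t < s -> mask (a t) (b t)) -> mask (num Q a s) (num Q b s).
  by rewrite QE => lta ltb; apply: (mask_num _ _).2.
(* All binary digits of [B] are 1, so masking by it is merely a bound. *)
have maskB y : y <= B -> mask y B by rewrite -ltnS Bc => /mask_ones.
have mask0 y : mask 0 y by rewrite /mask bin0.
have eQ n t : e n t < Q by apply: leq_ltn_trans Q1.
have dec_pos t : t < s -> ekind (ed (en t)) = Some false -> 0 < rr (ereg (ed (en t))) t.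
  by move=> lts kn; have := en_on t lts; rewrite /enabled kn => /andP[].
(* For a decrement edge the difference coded by [D] is exact, since the edge is taken only when its
   register is positive. *)
exists c, s, B, (Q ^ s), I, (st s).1, E, Rg, (fun r => num Q (fun t => rr r t.+1) s),
  (fun n => num Q (fun t => rr (ereg (ed n)) t - e n t) s), (fun r => rr r s).
rewrite /halting_system -/Q; split=> //; split=> //; split.
  by apply/(num_ones s Q1).
split; first by rewrite ltnS; move: ltcB; rewrite /c; clear; lia.
split; first by [].
split; first by [].
split.
  have := E_lin (fun=> 1); under eq_bigr do rewrite mul1n; exact.
split=> [n ltn|].
  by apply: masknum => // t lts; rewrite /e; case: eqP.
split=> [r ltr|].
  rewrite BI; apply: masknum => // t lts; last by rewrite maskB ?rrB.
  by apply: leq_ltn_trans ltBQ; apply: rrB.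
split=> [n ltn|].
  have [_ _ ltr] := ltM (in_edges ltn).
  case kn: (ekind (ed n)) => [[]|] //.
    split.
      rewrite num_add; apply: eq_num => t lts; rewrite subnK // /e.
      by case: eqP => // nE; rewrite nE dec_pos // -nE.
    have subB t : t < s -> rr (ereg (ed n)) t - e n t <= B.
      by move=> lts; apply: leq_trans (leq_subr _ _) _; apply: rrB.
    rewrite BI; apply: masknum => // t lts; last by rewrite maskB ?subB.
    by apply: leq_ltn_trans ltBQ; apply: subB.
  rewrite (E_lin (fun m => m != n)) num_mul; apply: masknum => t lts.
  - by apply: leq_ltn_trans ltBQ; apply: rrB.
  - by apply: leq_ltn_trans ltBQ; rewrite -[X in _ <= X]muln1 leq_mul ?leq_b1.
  case: eqP => [nE|_]; last by rewrite muln1 maskB ?rrB.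
  have := en_on t lts; rewrite nE /enabled kn => /andP[_ /eqP rn].
  by rewrite /rr rn.
have ltMQ : M < Q.
  by apply: leq_ltn_trans ltBQ; apply: leq_trans ltcB; rewrite /c; clear; lia.
split.
  rewrite (E_lin (fun n => etgt (ed n))) (E_lin (fun n => esrc (ed n))) -[LHS]add0n.
  apply/num_shift.
  - by apply: ltnW.
  - move=> t lts; have [_ lt _] := ltM (in_edges (en_lt t lts)); exact: ltn_trans ltMQ.
  - move=> t lts; have [lt _ _] := ltM (in_edges (en_lt t lts)); exact: ltn_trans ltMQ.
  have pcE t : t <= s -> (st t).1 = trace_of 0 (fun t => etgt (ed (en t))) t.
    by case: t => // t /stS[].
  split=> [t lts|]; last by rewrite pcE.
  by rewrite -pcE 1?ltnW //; have := en_on t lts; rewrite /enabled => /andP[/eqP].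
move=> r ltr; split.
  have rE t : rr r t = trace_of (if r == 0 then x else 0) (fun t => rr r t.+1) t.
    by case: t.
  have leSt t : t < s -> rr r t.+1 < Q.
    move=> lts; have [_ s2] := stS t lts; rewrite /rr s2 /act.
    apply: leq_ltn_trans (leq_subr _ _) _.
    by apply: leq_ltn_trans (leq_add (rrB r t ltr lts) (leq_b1 _)) _; rewrite /Q; lia.
  apply/num_shift => //.
  - by move: ltMQ ltcB; rewrite /c /Q; clear; case: eqP; lia.
  - by move=> t lts; apply: leq_ltn_trans ltBQ; apply: rrB.
rewrite !E_lin !num_add; apply: eq_num => t lts.
have [_ s2] := stS t lts; rewrite /rr s2 /act /cinc /cdec subnK //.
apply: leq_trans (leq_addr _ _); case kn: (_ == Some false) => //=.
case: eqP => //= <-; apply: dec_pos => //; exact/eqP.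
Qed.

End Simulation.

Lemma dio_foralln N (R : nat -> (nat -> nat) -> Prop) :
  (forall n, dio (R n)) -> dio (fun v => forall n, n < N -> R n v).
Proof.
move=> dR; elim: N => [|N IHN].
  apply: (@dio_ext (fun v => 0 = 0)) => //; apply: dio_eq; exact: dex_const.
apply: dio_ext (dio_and IHN (dR N)) => v; split=> [[H HN] n|H].
  by rewrite ltnS leq_eqVlt => /orP[/eqP->|/H].
by split=> [n lt|]; apply: H => //; apply: ltnW.
Qed.

Lemma dio_true : dio (fun=> True).
Proof. by apply: (@dio_ext (fun v => 0 = 0)) => //; apply: dio_eq; apply: dex_const. Qed.

(** The program is fixed, so sums and quantifiers over edges and registers have a fixed length. *)
Lemma dio_halts P x : dex x -> dio (fun v => halts_zero P (x v)).
Proof.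
move=> dx; have [M ltNM ltM] := edges_bound (edges P).
apply: (@dio_ext (fun v => exists c s B S I pcf E Rg A D F,
          halting_system P M (x v) c s B S I pcf E Rg A D F)).
  move=> v; split; last exact: halting_complete.
  by case=> c [s [B [S [I [pcf [E [Rg [A [D [F /halting_sound]]]]]]]]]]; apply.
rewrite /halting_system /cinc /cdec; do 6 apply: dio_ex; do 5 apply: dio_exs.
cbv beta.
repeat first [ apply dio_foralln; intro | apply dio_and ].
all: try (dio_arith; fail).
- apply dio_pow; dex_tac.
- apply dio_pow; dex_tac.
- apply dio_mask; dex_tac.
- apply dio_mask; dex_tac.
- case: (ekind _) => [[]|]; first exact: dio_true.
    apply: dio_and; first by apply dio_eq; dex_tac.
    by apply dio_mask; dex_tac.
  by apply dio_mask; dex_tac.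
by case: eqP => _; apply dio_eq; dex_tac.
Qed.

(** * Systems of equations as sentences *)

Local Notation vx := false (only parsing).
Local Notation vy := true (only parsing).
Definition All v f := Neg (Ex v (Neg f)).
Definition Imp f g := Or (Neg f) g.
Definition Iff f g := Or (And f g) (And (Neg f) (Neg g)).

Definition inH v := Pu 0 v.
Definition inS i v := Pb i v v.
Definition inC k v := Pu k.+1 v.

(* Once the extension H of inH has exactly half of the elements, this says that
   f has as many solutions in H as g has outside H. *)
Definition balanced v f g :=
  Pct CEq 50 1 v (Or (And (inH v) (Neg f)) (And (Neg (inH v)) g)).

Definition half_domain := Pct CEq 50 1 vx (inH vx).
(** The quantifier compares sets only across the border of H, so a set read outside H needs as many
    elements there as inside. *)
Definition mirrored i := balanced vx (inS i vx) (inS i vx).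
Definition singleton i := Ex vx (All vy (Iff (Equ vx vy) (And (inH vy) (inS i vy)))).

(* S_i codes the number of its elements in H; S_0 codes 1 and S_1 the input. The binary
   symbol j codes S_j by its diagonal and, off the diagonal, the relation witnessing the
   products by the number of S_j. *)
Fixpoint dform (f : dsys) : form :=
  match f with
  | DOne i => singleton i
  | DAdd i j k =>
      And (And (mirrored i) (mirrored k))
        (And (All vx (Imp (inS i vx) (inS k vx)))
             (balanced vx (inS j vx) (And (inS k vx) (Neg (inS i vx)))))
  | DMul i j k =>
      And (And (mirrored 0) (mirrored k))
        (And (All vx (Imp (And (inH vx) (inS i vx))
                         (balanced vy (inS j vy) (And (inS k vy) (Pb j vx vy)))))
             (All vx (Imp (And (Neg (inH vx)) (inS k vx))
                         (balanced vy (And (inS i vy) (Pb j vy vx)) (inS 0 vy)))))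
  | DAnd f g => And (dform f) (dform g)
  end.

Definition system_form (f : dsys) : form :=
  And (And half_domain (singleton 0))
      (And (All vx (Iff (And (inH vx) (inS 1 vx)) (inC 0 vx))) (dform f)).

(** Each step removes one element, down to the empty set of [chain_end]; counting by a descending
    chain needs only two variables. *)
Definition chain_step k :=
  Ex vx (And (Neg (inC k.+1 vx))
            (All vy (Iff (inC k vy) (Or (inC k.+1 vy) (Equ vx vy))))).

Definition chain_end k := Neg (Ex vx (inC k vx)).

(** The accumulator form lets a loop counting [k] down compute the code. *)
Fixpoint chain k (f : form) : form :=
  if k is k'.+1 then chain k' (And (chain_step k') f) else f.

Definition numeral m := chain m (chain_end m).

(** * From finite models to solutions *)

Section Eval.
Variables (n : nat) (M : structure n.+1).
Let N := n.+1.
Implicit Types (s : var -> 'I_N) (v : var).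

Lemma updE s v d : upd s v d v = d.
Proof. by rewrite /upd eqxx. Qed.

Lemma eval_Ex s v f : eval M s (Ex v f) = [exists d, eval M (upd s v d) f].
Proof. by []. Qed.

Lemma eval_And s f g : eval M s (And f g) = eval M s f && eval M s g.
Proof. by []. Qed.

Lemma eval_All s v f : eval M s (All v f) = [forall d, eval M (upd s v d) f].
Proof. by rewrite /= negb_exists; apply: eq_forallb => d; rewrite negbK. Qed.

Lemma eval_Imp s f g : eval M s (Imp f g) = (eval M s f ==> eval M s g).
Proof. by rewrite /= implybE. Qed.

Lemma eval_Iff s f g : eval M s (Iff f g) = (eval M s f == eval M s g).
Proof. by rewrite /=; case: (eval M s f); case: (eval M s g). Qed.

Definition cnt (p : 'I_N -> bool) : nat := \sum_(d < N) p d.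

Lemma card_cnt (p : 'I_N -> bool) : #|[pred d | p d]| = cnt p.
Proof.
by rewrite -sum1_card big_mkcond /=; apply: eq_bigr => d _; rewrite inE; case: (p d).
Qed.

Definition hS i := cnt (fun d => unary M 0 d && binary M i d d).

Lemma eval_half s : eval M s half_domain = (2 * cnt (unary M 0) == N).
Proof.
rewrite [LHS]/= card_cnt -[X in X == _]/(100 * 1 * cnt (unary M 0)) -/N.
by move: (cnt _) => a; apply/eqP/eqP; lia.
Qed.

Hypothesis halfM : 2 * cnt (unary M 0) = N.

(** If [c] counts the quantified formula, then c + a = |H| + b, so c is half of the domain iff a =
    b. *)
Lemma eval_balanced s v f g : eval M s (balanced v f g) =
  (cnt (fun d => unary M 0 d && eval M (upd s v d) f) ==
   cnt (fun d => ~~ unary M 0 d && eval M (upd s v d) g)).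
Proof.
rewrite /= card_cnt; set a := cnt (fun d => unary M 0 d && _).
set b := cnt (fun d => ~~ unary M 0 d && _); set c := cnt _.
have : c + a = cnt (unary M 0) + b.
  rewrite /c /a /b /cnt -!big_split; apply: eq_bigr => d _ /=.
  by rewrite updE; case: (unary M 0 d); case: (eval _ _ f); case: (eval _ _ g).
move: halfM; lia.
Qed.

Lemma eq_cnt p q : p =1 q -> cnt p = cnt q.
Proof. by move=> pq; apply: eq_bigr => d _; rewrite pq. Qed.

Lemma cnt_pred1 d p : (forall e, p e = (d == e)) -> cnt p = 1.
Proof.
move=> pE; rewrite /cnt (bigD1 d) //= pE eqxx big1 // => e ed.
by rewrite pE eq_sym (negbTE ed).
Qed.

Lemma eval_singleton s i : eval M s (singleton i) -> hS i = 1.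
Proof.
rewrite /singleton eval_Ex => /existsP[d]; rewrite eval_All => /forallP H.
apply: (@cnt_pred1 d) => e.
by have := H e; rewrite eval_Iff /= => /eqP->.
Qed.

Lemma eval_mirrored s i : eval M s (mirrored i) ->
  cnt (fun d => ~~ unary M 0 d && binary M i d d) = hS i.
Proof. by rewrite eval_balanced => /eqP. Qed.

Lemma dform_sound s f : hS 0 = 1 -> eval M s (dform f) -> dsat f hS.
Proof.
move=> S0; elim: f => [i|i j k|i j k|f IHf g IHg].
- exact: eval_singleton.
- rewrite [dform _]/= !eval_And eval_All eval_balanced.
  case/andP=> /andP[/eval_mirrored si /eval_mirrored sk] /andP[/forallP sub /eqP].
  rewrite /= -/(hS j) -sk -si => ->; rewrite /cnt -big_split; apply: eq_bigr => d _ /=.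
  by have := sub d; rewrite eval_Imp /=; do 2 case: (binary _ _ _ _); case: (unary _ _ _).
- rewrite [dform _]/= !eval_And !eval_All.
  case/andP=> /andP[/eval_mirrored s0 /eval_mirrored sk] /andP[/forallP Hi /forallP Hk].
  (* The related pairs are counted twice: by first component (S_j many successors each) and by
     second component (one predecessor each). *)
  pose p a c := (unary M 0 a && binary M i a a) &&
     (~~ unary M 0 c && (binary M k c c && binary M j a c)).
  have e1 : \sum_a \sum_c (p a c : nat) = hS i * hS j.
    rewrite /hS /cnt big_distrl /=; apply: eq_bigr => a _.
    have := Hi a; rewrite eval_Imp eval_balanced /= /upd /= /p.
    by case: (_ && _) => [/eqP/esym|_]; [rewrite mul1n|rewrite big1].
  have e2 : \sum_a \sum_c (p a c : nat) = hS k * hS 0.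
    rewrite exchange_big /= -sk /cnt big_distrl /=; apply: eq_bigr => c _.
    have := Hk c; rewrite eval_Imp eval_balanced /= /upd /= s0 /p.
    case: (unary M 0 c); case: (binary M k c c); rewrite /= ?mul0n => H;
      try by rewrite big1 // => a _; rewrite ?andbF.
    rewrite mul1n -(eqP H) /cnt; apply: eq_bigr => a _.
    by rewrite -andbA.
  by rewrite /= -e1 e2 S0 muln1.
by case/andP=> /IHf ? /IHg.
Qed.

Lemma chain_sound s k f : eval M s (chain k f) -> eval M s f /\
  cnt (unary M 1) = cnt (unary M k.+1) + k.
Proof.
elim: k f => [|k IHk] f; first by rewrite addn0.
case/IHk; rewrite eval_And /chain_step eval_Ex => /andP[/existsP[d]].
rewrite eval_And eval_All => /andP[nd /forallP H] fs ->; split=> //.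
rewrite addnS -addSn; congr (_ + k).
rewrite -[RHS]addn1 -[X in _ = _ + X](@cnt_pred1 d (fun e => d == e)) //.
rewrite /cnt -big_split.
apply: eq_bigr => e _ /=; have := H e; rewrite eval_Iff /= /upd /= => /eqP->.
move: nd; rewrite /= /upd /=; case: eqP => [<- /negbTE->//|_ _].
by rewrite orbF addn0.
Qed.

End Eval.

Lemma system_sound f m :
  fin_sat (And (system_form f) (numeral m)) ->
  exists u, [/\ u 0 = 1, u 1 = m & dsat f u].
Proof.
case=> n [M]; rewrite /system_form !eval_And eval_All.
rewrite eval_half => /andP[/andP[/andP[/eqP halfM /eval_singleton S0]]].
move=> /andP[/forallP link].
move=> /(dform_sound halfM S0) fs /chain_sound[end0 cC].
exists (hS M); split=> //; rewrite /hS.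
have -> : m = cnt (unary M 1).
  rewrite cC /cnt big1 // => d _; apply/eqP; rewrite eqb0; apply/negP => Cd.
  by move/existsP: end0; case; exists d.
by apply: eq_cnt => d; have := link d; rewrite eval_Iff /= => /eqP.
Qed.

(** * From solutions to finite models *)

Section Model.
Variables (b m : nat) (u : nat -> nat).
Hypotheses (u0 : u 0 = 1) (u1 : u 1 = m) (lemb : m <= b).
Let B := b.+1.

(* The first half of the domain is H; both halves are indexed by [0, B[. *)
Let lo (i : 'I_B) : 'I_(b + B).+1 := @lshift B B i.
Let hi (i : 'I_B) : 'I_(b + B).+1 := @rshift B B i.

Let idx (d : 'I_(b + B).+1) : nat := if d < B then d : nat else d - B.

(** Sets are initial segments of the halves. Off the diagonal, symbol i relates a to the block [a
    u_i, (a+1) u_i). This depends on i alone, so all products with that second factor share the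
    relation. *)
Definition std_model : structure (b + B).+1 := @Structure (b + B).+1
  (fun k d => if k is k'.+1 then (d < B) && (d < m - k') else d < B)
  (fun i d d' => if d == d' then idx d < u i else idx d' %/ u i == idx d).
Let M := std_model.

Let cnt_halves (p : 'I_(b + B).+1 -> bool) :
  cnt p = \sum_(i < B) p (lo i) + \sum_(i < B) p (hi i).
Proof. exact: (@big_split_ord nat 0 addn B B predT (fun d => nat_of_bool (p d))). Qed.

Let lo_lt i : lo i < B.
Proof. exact: (ltn_ord i). Qed.

Let hi_lt i : (hi i < B) = false.
Proof. by rewrite ltnNge; apply/negbF; exact: (leq_addr i B). Qed.

Let idxl i : idx (lo i) = i.
Proof. by rewrite /idx lo_lt. Qed.

Let idxr i : idx (hi i) = i.
Proof. by rewrite /idx hi_lt; exact: (addKn B i). Qed.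

Let Hl i : unary M 0 (lo i).
Proof. exact: lo_lt. Qed.

Let Hr i : unary M 0 (hi i) = false.
Proof. exact: hi_lt. Qed.

Let Sd i d : binary M i d d = (idx d < u i).
Proof. by rewrite /= eqxx. Qed.

Let lohi k l : (lo k == hi l) = false.
Proof. by apply/eqP => e; have := lo_lt k; rewrite e hi_lt. Qed.

Let cntH (p : 'I_(b + B).+1 -> bool) :
  cnt (fun d => unary M 0 d && p d) = \sum_(i < B) p (lo i).
Proof.
rewrite cnt_halves [X in _ + X]big1 ?addn0 => [|i _]; last by rewrite Hr.
by apply: eq_bigr => i _; rewrite Hl.
Qed.

Let cntNH (p : 'I_(b + B).+1 -> bool) :
  cnt (fun d => ~~ unary M 0 d && p d) = \sum_(i < B) p (hi i).
Proof.
rewrite cnt_halves big1 ?add0n => [|i _]; last by rewrite Hl.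
by apply: eq_bigr => i _; rewrite Hr.
Qed.

Let sum_lt k c : c <= k -> \sum_(i < k) (i < c) = c.
Proof.
elim: k => [|k IHk]; first by rewrite leqn0 => /eqP->; rewrite big_ord0.
rewrite leq_eqVlt big_ord_recr /= => /orP[/eqP->|].
  rewrite ltnSn addn1; congr _.+1; rewrite -[RHS](card_ord k) -sum1_card.
  by apply: eq_bigr => i _; rewrite ltnS ltnW.
by rewrite ltnS => lek; rewrite IHk // ltnNge lek addn0.
Qed.

Let halfM : 2 * cnt (unary M 0) = (b + B).+1.
Proof.
have := cntH (fun=> true).
rewrite (@eq_cnt _ _ (unary M 0)) => [->|d]; last by rewrite andbT.
by rewrite sum_nat_const card_ord muln1 mul2n -addnn.
Qed.

(** Only the numbers mentioned by the system must fit into a half; the others may be cut off. *)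
Fixpoint dbound (f : dsys) : nat :=
  match f with
  | DOne i => u i
  | DAdd i j k | DMul i j k => u i + u j + u k
  | DAnd g h => dbound g + dbound h
  end.

Let mirroredM s i : eval M s (mirrored i).
Proof.
rewrite (eval_balanced halfM) cntH cntNH; apply/eqP; apply: eq_bigr => d _.
by rewrite /inS /eval !updE !Sd idxl idxr.
Qed.

Let singletonM s i : u i = 1 -> eval M s (singleton i).
Proof.
move=> ui; rewrite /singleton eval_Ex; apply/existsP; exists (lo ord0).
rewrite eval_All; apply/forallP => d.
rewrite eval_Iff -[eval M _ (And _ _)]/(unary M 0 d && binary M i d d) Sd ui ltnS.
rewrite -[eval M _ _]/(lo ord0 == d) leqn0 /idx -[unary M 0 d]/(d < B).
rewrite [lo _ == _]eq_sym -val_eqE /=; case: ltnP => [_|] /=; first by rewrite eqxx.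
by case: (nat_of_ord d).
Qed.

Let sum_div i k l (a : 'I_B) : u i * u l = u k -> u k <= B -> a < u i ->
  \sum_(c < B) ((c < u k) && (c %/ u l == a)) = u l.
Proof.
move=> ikl lek lta; have [ul0|ul0] := posnP (u l).
  by rewrite big1 // => c _; rewrite -ikl ul0 muln0 ltn0.
have le1 : a.+1 * u l <= u k by rewrite -ikl leq_mul2r lta orbT.
(* The counted numbers form the interval [a u_l, (a+1) u_l); adding the segment below it gives an
   initial segment. *)
apply: (@addnI (\sum_(c < B) (c < a * u l))).
rewrite -big_split /= sum_lt; last first.
  by apply: leq_trans lek; apply: leq_trans le1; rewrite leq_mul2r leqnSn orbT.
rewrite addnC -mulSn -[RHS](sum_lt (leq_trans le1 lek)); apply: eq_bigr => c _.
have -> : (c %/ u l == a) = (a * u l <= c) && (c < a.+1 * u l).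
  by rewrite eqn_leq -ltnS ltn_divLR // leq_divRL // andbC.
case: (ltnP c (a.+1 * u l)) => [lt1|le2].
  by rewrite (leq_trans lt1 le1) andbT /=; case: leqP.
by rewrite !andbF [c < a * _]ltnNge (leq_trans _ le2) // leq_mul2r leqnSn orbT.
Qed.

Lemma dform_complete s f : dbound f <= B -> dsat f u -> eval M s (dform f).
Proof.
elim: f => [i|i j k|i j k|f IHf g IHg];
  rewrite [dbound _]/= [dsat _ _]/= [dform _]/= => le_B.
- exact: singletonM.
- move=> ijk; rewrite !eval_And !mirroredM !andTb eval_All (eval_balanced halfM) cntH cntNH.
  apply/andP; split.
    apply/forallP => d; rewrite eval_Imp /inS /eval !updE !Sd; apply/implyP.
    by move=> lt; apply: leq_trans lt _; rewrite -ijk leq_addr.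
  under eq_bigr do rewrite /inS /eval updE Sd idxl.
  under [X in _ == X]eq_bigr do rewrite /inS /eval updE !Sd idxr.
  rewrite sum_lt; last by lia.
  rewrite -(eqn_add2l (u i)) ijk -{1}(@sum_lt B (u k)); last by lia.
  rewrite -{1}(@sum_lt B (u i)); last by lia.
  rewrite -big_split /=; apply/eqP; apply: eq_bigr => c _.
  by case: (ltnP c (u i)) => [lt|_]; rewrite ?andbT // -ijk (leq_trans lt) ?leq_addr.
- move=> ijk; rewrite !eval_And !mirroredM !andTb !eval_All.
  have le_ik : u k <= B by lia.
  apply/andP; split; apply/forallP => d; rewrite eval_Imp (eval_balanced halfM) cntH cntNH;
    apply/implyP => /=; rewrite /upd /= ?eqxx => /andP[Hd].
    have [a ->] : exists a, d = lo a by exists (Ordinal Hd); apply: val_inj.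
    rewrite idxl => lta; apply/eqP.
    under eq_bigr do rewrite eqxx idxl.
    rewrite sum_lt; last by lia.
    rewrite -[LHS](sum_div ijk le_ik lta); apply: eq_bigr => c _.
    by rewrite eqxx lohi !idxr ?idxl.
  have [c ->] : exists c, d = hi c.
    have ltd : d - B < B by have := ltn_ord d; rewrite -leqNgt in Hd; lia.
    by exists (Ordinal ltd); apply: val_inj; rewrite /= subnKC // leqNgt.
  rewrite idxr => ltc; apply/eqP.
  under [RHS]eq_bigr do rewrite eqxx idxr u0.
  rewrite [RHS]sum_lt //.
  have j0 : 0 < u j by case: (u j) ijk ltc => // <-; rewrite muln0.
  have lt_ci : c %/ u j < u i by rewrite ltn_divLR // ijk.
  have lt_cB : c %/ u j < B by apply: leq_trans lt_ci _; lia.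
  (* The only predecessor of [c] has index c / u_j. *)
  rewrite (bigD1 (Ordinal lt_cB)) //= eqxx idxl lt_ci.
  rewrite lohi ?idxl ?idxr eqxx big1 // => a ne_a.
  rewrite eqxx lohi ?idxl ?idxr.
  by move: ne_a; rewrite -val_eqE eq_sym /= => /negbTE->; rewrite andbF.
by case=> fu gu; rewrite eval_And IHf ?IHg //; lia.
Qed.

Let chain_stepM s k : k < m -> eval M s (chain_step k).
Proof.
(* C_k consists of the first m - k elements of H, so the element removed at step k is m - k - 1. *)
move=> ltkm; have lt_d : m - k.+1 < B by lia.
rewrite /chain_step eval_Ex; apply/existsP; exists (lo (Ordinal lt_d)).
rewrite eval_And eval_All; apply/andP; split; first by rewrite /= ltnn andbF.
apply/forallP => d; rewrite eval_Iff /= /upd /= -val_eqE /=.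
case: (ltnP d B) => leBd /=; last by apply/eqP/esym/eqP; lia.
by apply/eqP; lia.
Qed.

Let chainM s k f : k <= m -> eval M s f -> eval M s (chain k f).
Proof.
elim: k f => //= k IHk f ltkm fs; apply: IHk; first exact: ltnW.
by rewrite eval_And chain_stepM.
Qed.

Lemma system_complete_model f : dbound f <= B -> dsat f u ->
  fin_sat (And (system_form f) (numeral m)).
Proof.
move=> le_f fu; exists (b + B), M; set s := fun _ => _.
rewrite /system_form !eval_And eval_All (eval_half M) halfM eqxx singletonM //.
rewrite dform_complete // !andTb andbT; apply/andP; split; last first.
  apply: chainM => //; apply/existsP => -[d] /=.
  by rewrite subnn ltn0 andbF.
apply/forallP => d; rewrite eval_Iff /= /upd /= eqxx u1 subn0 /idx.
by case: ltnP.
Qed.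
End Model.

Lemma system_spec f m :
  fin_sat (And (system_form f) (numeral m)) <->
  exists u, [/\ u 0 = 1, u 1 = m & dsat f u].
Proof.
split=> [/system_sound //|[u [u0 u1 fu]]].
pose b := m + dbound u f.
have le_b : dbound u f <= b.+1 by apply: leqW; apply: leq_addl.
by apply: (system_complete_model u0 u1 _ le_b fu); apply: leq_addr.
Qed.

Definition closed_half f := [&& wf f, ~~ free vx f, ~~ free vy f & only_half f].

Lemma closed_half_And f g : closed_half (And f g) = closed_half f && closed_half g.
Proof.
rewrite /closed_half /= !negb_or.
by case: (wf f); case: (wf g); case: (free vx f); case: (free vx g);
   case: (free vy f); case: (free vy g); case: (only_half f); case: (only_half g).
Qed.

Lemma closed_half_dform f : closed_half (dform f).
Proof.
by elim: f => [i|i j k|i j k|f IHf g IHg] //=; rewrite closed_half_And IHf.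
Qed.

Lemma closed_half_chain k f : closed_half f -> closed_half (chain k f).
Proof. by elim: k f => //= k IHk f cf; apply: IHk; rewrite closed_half_And. Qed.

Lemma closed_half_system f m : closed_half (And (system_form f) (numeral m)).
Proof.
rewrite closed_half_And /system_form !closed_half_And closed_half_dform.
exact: closed_half_chain.
Qed.

(** * A machine computing the self-referential sentence *)

Inductive cmd :=
| CInc (r : nat)
| CSeq (c d : cmd)
| CLoop (r : nat) (c : cmd).

(* CLoop r c is "while r > 0 do r := r - 1; c". *)
Inductive bigstep : cmd -> (nat -> nat) -> (nat -> nat) -> Prop :=
| BInc r R : bigstep (CInc r) R (setreg R r (R r).+1)
| BSeq c d R1 R2 R3 : bigstep c R1 R2 -> bigstep d R2 R3 -> bigstep (CSeq c d) R1 R3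
| BLoop0 r c R : R r = 0 -> bigstep (CLoop r c) R R
| BLoopS r c R1 R2 R3 k : R1 r = k.+1 -> bigstep c (setreg R1 r k) R2 ->
    bigstep (CLoop r c) R2 R3 -> bigstep (CLoop r c) R1 R3.

Fixpoint csize c :=
  match c with
  | CInc _ => 1
  | CSeq c d => csize c + csize d
  | CLoop _ c => (csize c).+1
  end.

(* Code for c placed at address a and leaving to address b. *)
Fixpoint compile c (a b : nat) : program :=
  match c with
  | CInc r => [:: Inc r b]
  | CSeq c d => compile c a (a + csize c) ++ compile d (a + csize c) b
  | CLoop r c => Dec r a.+1 b :: compile c a.+1 a
  end.

Lemma size_compile c a b : size (compile c a b) = csize c.
Proof.
elim: c a b => [r|c IHc d IHd|r c IHc] a b //=; first by rewrite size_cat IHc IHd.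
by rewrite IHc.
Qed.

Definition placed (P : program) (a : nat) (code : program) :=
  exists p q, P = p ++ code ++ q /\ size p = a.

Lemma placed_catl P a c d : placed P a (c ++ d) -> placed P a c.
Proof. by case=> p [q [-> <-]]; exists p, (d ++ q); rewrite -!catA. Qed.

Lemma placed_catr P a c d : placed P a (c ++ d) -> placed P (a + size c) d.
Proof.
by case=> p [q [-> <-]]; exists (p ++ c), q; rewrite size_cat -!catA.
Qed.

Lemma placed_nth P a i c : placed P a (i :: c) -> nth None (map Some P) a = Some i.
Proof. by case=> p [q [-> <-]]; rewrite map_cat nth_cat size_map ltnn subnn. Qed.

(** By induction on the derivation, as each loop iteration reuses the same code at the same
    address. *)
Lemma compile_correct c R R' : bigstep c R R' -> forall P a b,
  placed P a (compile c a b) -> exists k, iter k (step P) (a, R) = (b, R').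
Proof.
elim=> {c R R'} [r R|c d R1 R2 R3 _ IHc _ IHd|r c R Rr|r c R1 R2 R3 k Rr _ IHc _ IHl]
  P a b /= at_a.
- by exists 1; rewrite /= (placed_nth at_a).
- have [k1 e1] := IHc P a _ (placed_catl at_a).
  have := placed_catr at_a; rewrite size_compile => /IHd[k2 e2].
  by exists (k2 + k1); rewrite iterD e1.
- by exists 1; rewrite /= (placed_nth at_a) Rr.
have [k1 e1] := IHl P a b at_a.
have [|k2 e2] := IHc P a.+1 a; first by have := @placed_catr P a [:: _] _ at_a; rewrite addn1.
exists (k1 + (k2 + 1)); rewrite !iterD /= (placed_nth at_a) Rr.
by rewrite e2.
Qed.

Definition shift_instr a ins :=
  match ins with
  | Inc r j => Inc r (a + j)
  | Dec r j k => Dec r (a + j) (a + k)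
  end.

Lemma step_shift p P pc R :
  step (p ++ map (shift_instr (size p)) P) (size p + pc, R) =
  (size p + (step P (pc, R)).1, (step P (pc, R)).2).
Proof.
rewrite /step map_cat nth_cat size_map ltnNge leq_addr /= addKn.
have [ltP|leP] := ltnP pc (size P); last by rewrite !nth_default ?size_map.
rewrite -map_comp !(nth_map (Inc 0 0)) //=.
by case: (nth _ _ _) => [r j|r j k] //=; case: (R r).
Qed.

Definition prepend (c : cmd) (P : program) : program :=
  compile c 0 (csize c) ++ map (shift_instr (csize c)) P.

Lemma run_prepend c P m n : bigstep c (init m).2 (init n).2 ->
  exists k, forall j, run (prepend c P) (j + k) m =
    (csize c + (run P j n).1, (run P j n).2).
Proof.
move=> cmn; have [|k ek] := compile_correct cmn (P := prepend c P) (a := 0) (b := csize c).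
  by exists [::], (map (shift_instr (csize c)) P).
exists k => j; rewrite /run iterD ek; elim: j => [|j IHj]; first by rewrite /= addn0.
rewrite !iterS IHj; case: (iter j (step P) (init n)) => pc R /=.
by have := step_shift (compile c 0 (csize c)) P pc R; rewrite size_compile.
Qed.

Ltac regs := apply: functional_extensionality => ?; rewrite /setreg;
  repeat (case: eqP => [?|?] /=; try subst); try lia.

Lemma bigstep_eq c R R1 R2 : R1 = R2 -> bigstep c R R1 -> bigstep c R R2.
Proof. by move=> ->. Qed.

Definition cmove r d := CLoop r (CInc d).

Lemma bs_move r d R : r <> d ->
  bigstep (cmove r d) R (setreg (setreg R r 0) d (R d + R r)).
Proof.
move=> rd; move Rr: (R r) => n; elim: n R Rr => [|n IHn] R Rr.
  apply: (@bigstep_eq _ _ R); last exact: BLoop0.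
  regs.
apply: BLoopS Rr (BInc _ _) _.
have := IHn (setreg (setreg R r n) d (setreg R r n d).+1).
have e1 : setreg (setreg R r n) d (setreg R r n d).+1 r = n.
  by rewrite /setreg eqxx; case: eqP.
move/(_ e1); apply: bigstep_eq; regs.
Qed.

Definition cmove2 r d e := CLoop r (CSeq (CInc d) (CInc e)).

Lemma bs_move2 r d e R : uniq [:: r; d; e] -> 
  bigstep (cmove2 r d e) R
    (setreg (setreg (setreg R r 0) d (R d + R r)) e (R e + R r)).
Proof.
rewrite /= !inE negb_or andbT => /andP[/andP[/eqP rd /eqP re] /eqP de].
move Rr: (R r) => n; elim: n R Rr => [|n IHn] R Rr.
  apply: (@bigstep_eq _ _ R); last exact: BLoop0.
  regs.
apply: BLoopS Rr (BSeq (BInc _ _) (BInc _ _)) _.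
set R1 := setreg _ e _; have e1 : R1 r = n.
  by rewrite /R1 /setreg; do !case: eqP => //.
apply: bigstep_eq (IHn R1 e1); rewrite /R1; regs.
Qed.

(** Reading a register empties it, so its value is also kept in the scratch register [t] and moved
    back. *)
Definition ccopy r d t := CSeq (cmove2 r d t) (cmove t r).

Lemma bs_copy r d t R : uniq [:: r; d; t] -> R t = 0 ->
  bigstep (ccopy r d t) R (setreg R d (R d + R r)).
Proof.
move=> U Rt; apply: BSeq (bs_move2 R U) _.
move: U; rewrite /= !inE negb_or andbT => /andP[/andP[/eqP rd /eqP re] /eqP de].
apply: bigstep_eq (bs_move _ _); last by congruence.
by regs.
Qed.

(* Turns (n, _, v) in registers x, x+1, x+2 into (0, _, v + n (n + 1) / 2). *)
Definition ctriangle x :=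
  CLoop x (CSeq (CInc (x + 2)) (CSeq (cmove2 x (x + 2) (x + 3)) (cmove (x + 3) x))).

Lemma bs_triangle x R : R (x + 3) = 0 ->
  bigstep (ctriangle x) R
    (setreg (setreg R x 0) (x + 2) (R (x + 2) + (R x * (R x).+1)./2)).
Proof.
move Rx: (R x) => n; elim: n R Rx => [|n IHn] R Rx R3.
  apply: (@bigstep_eq _ _ R); last exact: BLoop0.
  regs.
pose R1 := setreg (setreg R x n) (x + 2) (R (x + 2) + n.+1).
apply: (BLoopS (R2 := R1)) Rx _ _.
  apply: BSeq (BInc _ _) _; apply: BSeq (bs_move2 _ _) _.
    by rewrite /= !inE; apply/and3P; split; lia.
  apply: bigstep_eq (bs_move _ _); last by lia.
  by rewrite /R1; regs.
have [e1 e3] : R1 x = n /\ R1 (x + 3) = 0.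
  by rewrite /R1 /setreg; split; do !(case: eqP => ?; try lia).
apply: bigstep_eq (IHn R1 e1 e3); rewrite /R1.
have tri : (n.+1 * n.+2)./2 = n.+1 + (n * n.+1)./2.
  have -> : n.+1 * n.+2 = n.+1.*2 + n * n.+1 by lia.
    by rewrite halfD odd_double doubleK.
regs.
Qed.

(** Register x + 2 receives the second argument, then the triangular number of the sum. *)
Definition ccantor x :=
  CSeq (cmove2 (x + 1) x (x + 2)) (CSeq (ctriangle x) (cmove (x + 2) x)).

Lemma bs_cantor x R : R (x + 2) = 0 -> R (x + 3) = 0 ->
  bigstep (ccantor x) R (setreg (setreg R (x + 1) 0) x (cantor (R x) (R (x + 1)))).
Proof.
move=> R2 R3; apply: BSeq (bs_move2 _ _) _.
  by rewrite /= !inE; apply/and3P; split; lia.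
set R' := setreg _ (x + 2) _.
have [e0 [e2 e3]] : R' x = R x + R (x + 1) /\ R' (x + 2) = R (x + 1) /\ R' (x + 3) = 0.
  by rewrite /R' /setreg; do !split; do !(case: eqP => ?; try lia).
apply: BSeq (bs_triangle e3) _; rewrite e0 e2.
apply: bigstep_eq (bs_move _ _); last by lia.
rewrite /R' /cantor; move: (half _) => h; regs.
Qed.

(** * Evaluating codes of formulas in registers *)

Inductive nexp := NVar (r : nat) | NZero | NSucc (e : nexp) | NCantor (e f : nexp).

Fixpoint neval (R : nat -> nat) e :=
  match e with
  | NVar r => R r
  | NZero => 0
  | NSucc e => (neval R e).+1
  | NCantor e f => cantor (neval R e) (neval R f)
  end.

Fixpoint nbelow d e :=
  match e with
  | NVar r => r < d
  | NZero => true
  | NSucc e => nbelow d e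
  | NCantor e f => nbelow d e && nbelow d f
  end.

(** Registers from [d] on act as an initially zero stack, and the result lands in [d]. For [NZero]
    the loop is never entered, so it does nothing. *)
Fixpoint ceval e d :=
  match e with
  | NVar r => ccopy r d d.+1
  | NZero => CLoop d (CInc d)
  | NSucc e => CSeq (ceval e d) (CInc d)
  | NCantor e f => CSeq (ceval e d) (CSeq (ceval f d.+1) (ccantor d))
  end.

Lemma nbelowS d e : nbelow d e -> nbelow d.+1 e.
Proof.
by elim: e => //= [r /ltnW //|e IHe f IHf /andP[/IHe-> /IHf->]].
Qed.

Lemma neval_setreg R e d x : nbelow d e -> neval (setreg R d x) e = neval R e.
Proof.
elim: e => //= [r ltr|e IHe /IHe->|e IHe f IHf /andP[/IHe-> /IHf->]] //.
by rewrite /setreg; case: eqP => // e; rewrite e ltnn in ltr.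
Qed.

Lemma bs_eval e d R : nbelow d e -> (forall i, d <= i -> R i = 0) ->
  bigstep (ceval e d) R (setreg R d (neval R e)).
Proof.
elim: e d R => [r|||] //=.
- move=> d R ltr Rd; apply: bigstep_eq (bs_copy _ _).
  + by rewrite Rd.
  + by rewrite /= !inE; apply/and3P; split; lia.
  + by rewrite Rd.
- move=> d R _ Rd; apply: (@bigstep_eq _ _ R); last by apply: BLoop0; apply: Rd.
  have := Rd d (leqnn d) => Rd0; regs.
- move=> e IHe d R lte Rd; apply: BSeq (IHe d R lte Rd) _.
  by apply: bigstep_eq (BInc _ _); regs.
move=> e IHe f IHf d R /andP[lte ltf] Rd; apply: BSeq (IHe d R lte Rd) _.
set R1 := setreg R d _.
have R1d i : d < i -> R1 i = 0.
  by move=> lti; rewrite /R1 /setreg; case: eqP => [|_]; [lia|apply: Rd; apply: ltnW].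
apply: BSeq (IHf d.+1 R1 (nbelowS ltf) R1d) _.
rewrite {2}/R1 neval_setreg //; set R2 := setreg R1 _ _.
have R2d i : d.+1 < i -> R2 i = 0.
  by move=> lti; rewrite /R2 /setreg; case: eqP => [|_]; [lia|apply: R1d; lia].
apply: bigstep_eq (bs_cantor _ _); try by apply: R2d; lia.
have -> : R2 d = neval R e.
  by rewrite /R2 /setreg; case: eqP => [|_]; [lia|rewrite /R1 /setreg eqxx].
have -> : R2 (d + 1) = neval R f by rewrite addn1 /R2 /setreg eqxx.
have Rd1 := Rd d.+1 (leqnSn d); rewrite /R2 /R1 addn1; regs.
Qed.

Definition nconst n := iter n NSucc NZero.

(* The code of f, with the indices of unary symbols given by expressions. *)
Fixpoint quote (q : nat -> nexp) (f : form) : nexp :=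
  match f with
  | Pu i v => NCantor NZero (NCantor (q i) (nconst v))
  | Pb i v w => NCantor (nconst 1) (NCantor (nconst i) (NCantor (nconst v) (nconst w)))
  | Equ v w => NCantor (nconst 2) (NCantor (nconst v) (nconst w))
  | Neg g => NCantor (nconst 3) (quote q g)
  | And g h => NCantor (nconst 4) (NCantor (quote q g) (quote q h))
  | Or g h => NCantor (nconst 5) (NCantor (quote q g) (quote q h))
  | Ex v g => NCantor (nconst 6) (NCantor (nconst v) (quote q g))
  | Pct c a b v g => NCantor (nconst 7) (NCantor (nconst (enc_cmp c))
      (NCantor (nconst a) (NCantor (nconst b) (NCantor (nconst v) (quote q g)))))
  end.

(** [chain_step k] is [chain_step 0] with all unary indices raised by [k], so one expression reading
    [k] from a register codes every step. *)
Definition shifted r i := iter i NSucc (NVar r).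

Lemma neval_step R : neval R (quote (shifted 1) (chain_step 0)) = enc (chain_step (R 1)).
Proof. reflexivity. Qed.

Lemma neval_end R : neval R (quote (shifted 0) (chain_end 0)) = enc (chain_end (R 0)).
Proof. reflexivity. Qed.

Definition nand e f := NCantor (nconst 4) (NCantor e f).

Lemma neval_nand R e f : neval R (nand e f) = cantor 4 (cantor (neval R e) (neval R f)).
Proof. by []. Qed.

(** With [z] at zero the inner loop is an empty body. *)
Definition cclear r z := CLoop r (CLoop z (CInc z)).

Lemma bs_clear r z R : r <> z -> R z = 0 -> bigstep (cclear r z) R (setreg R r 0).
Proof.
move=> rz; move Rr: (R r) => n; elim: n R Rr => [|n IHn] R Rr Rz.
  by apply: (@bigstep_eq _ _ R); [regs|exact: BLoop0].
have e1 : setreg R r n z = 0 by rewrite /setreg; case: eqP => // /esym.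
apply: BLoopS Rr (BLoop0 _ e1) _.
by apply: bigstep_eq (IHn _ _ e1); [regs|rewrite /setreg eqxx].
Qed.

(* Register 0 holds m, register 1 the loop counter, register 2 the accumulator. *)
Definition csubst_loop : cmd :=
  CLoop 1 (CSeq (ceval (nand (quote (shifted 1) (chain_step 0)) (NVar 2)) 3)
                (CSeq (cclear 2 4) (cmove 3 2))).

Definition csubst : cmd :=
  CSeq (ccopy 0 1 2)
  (CSeq (ceval (quote (shifted 0) (chain_end 0)) 2)
  (CSeq csubst_loop
  (CSeq (ceval (nand (NVar 0) (NVar 2)) 3)
  (CSeq (cclear 0 4) (CSeq (cclear 2 4) (cmove 3 0)))))).

Definition regs4 a b c d i := match i with 0 => a | 1 => b | 2 => c | 3 => d | _ => 0 end.

Lemma set4 a b c d x :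
  [/\ setreg (regs4 a b c d) 0 x = regs4 x b c d,
      setreg (regs4 a b c d) 1 x = regs4 a x c d,
      setreg (regs4 a b c d) 2 x = regs4 a b x d &
      setreg (regs4 a b c d) 3 x = regs4 a b c x].
Proof. by split; apply: functional_extensionality => -[|[|[|[|i]]]]. Qed.

Lemma bs_eval4 e a b c : nbelow 3 e ->
  bigstep (ceval e 3) (regs4 a b c 0) (regs4 a b c (neval (regs4 a b c 0) e)).
Proof.
move=> be; apply: bigstep_eq (bs_eval be _); last by case=> [|[|[|[|i]]]].
by have [_ _ _ ->] := set4 a b c 0 (neval (regs4 a b c 0) e).
Qed.

Lemma bs_csubst_loop m k f :
  bigstep csubst_loop (regs4 m k (enc f) 0) (regs4 m 0 (enc (chain k f)) 0).
Proof.
elim: k f => [|k IHk] f; first exact: BLoop0.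
apply: BLoopS (erefl k.+1) _ (IHk (And (chain_step k) f)).
have [_ -> _ _] := set4 m k.+1 (enc f) 0 k.
apply: BSeq (bs_eval4 _ _ _ _) _; first by [].
rewrite neval_nand neval_step; set E := cantor _ _.
apply: (@BSeq _ _ _ (regs4 m k 0 E)).
  apply: bigstep_eq (bs_clear _ _) => //.
  by have [_ _ -> _] := set4 m k (enc f) E 0.
apply: bigstep_eq (bs_move _ _) => //.
have [_ _ _ ->] := set4 m k 0 E 0.
by have [_ _ -> _] := set4 m k 0 0 (0 + E).
Qed.

Lemma init4 n : (init n).2 = regs4 n 0 0 0.
Proof. by apply: functional_extensionality => -[|[|[|[|i]]]]. Qed.

Lemma bs_csubst g : let m := enc g in
  bigstep csubst (init m).2 (init (enc (And g (numeral m)))).2.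
Proof.
move=> m; rewrite !init4.
apply: (@BSeq _ _ _ (regs4 m m 0 0)).
  apply: bigstep_eq (bs_copy _ _) => //.
  by have [_ -> _ _] := set4 m 0 0 0 (0 + m).
apply: (@BSeq _ _ _ (regs4 m m (enc (chain_end m)) 0)).
  apply: bigstep_eq (bs_eval _ _) => //; last by case=> [|[|[|[|i]]]].
  rewrite neval_end; by have [_ _ -> _] := set4 m m 0 0 (enc (chain_end m)).
apply: BSeq (bs_csubst_loop m m _) _; rewrite -/(numeral m).
set E := enc (And g (numeral m)).
apply: (@BSeq _ _ _ (regs4 m 0 (enc (numeral m)) E)); first exact: bs_eval4.
apply: (@BSeq _ _ _ (regs4 0 0 (enc (numeral m)) E)).
  apply: bigstep_eq (bs_clear _ _) => //.
  by have [-> _ _ _] := set4 m 0 (enc (numeral m)) E 0.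
apply: (@BSeq _ _ _ (regs4 0 0 0 E)).
  apply: bigstep_eq (bs_clear _ _) => //.
  by have [_ _ -> _] := set4 0 0 (enc (numeral m)) E 0.
apply: bigstep_eq (bs_move _ _) => //.
have [_ _ _ ->] := set4 0 0 0 E 0.
by have [-> _ _ _] := set4 0 0 0 0 (0 + E).
Qed.

(** * Undecidability *)

Lemma halts_zero_prepend c P m n : bigstep c (init m).2 (init n).2 ->
  halts_zero (prepend c P) m <-> halts_zero P n.
Proof.
move=> /(run_prepend P)[k runE].
have haltE j : halted (prepend c P) (run (prepend c P) (j + k) m) =
    halted P (run P j n).
  by rewrite runE /halted /prepend size_cat size_compile size_map leq_add2l.
split=> -[j [hj zj]]; last by exists (j + k); rewrite haltE runE.
(* Running the halted machine for [k] further steps aligns it with the run of [P] after the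
   prefix. *)
exists j; rewrite -haltE; have e := run_halted hj k; split; first by rewrite e.
by have := congr1 (fun c => c.2 0) (runE j); rewrite e zj.
Qed.

Lemma no_half_decider : ~ exists P : program,
  forall f : form, sentence f -> only_half f -> rm_answers P (enc f) (fin_sat f).
Proof.
case=> P decides; pose Q := prepend csubst P.
have [f fP] := dio_halts Q (dex_var 0).
(* Shifting the variables frees position 0 for the constant 1 and moves the parameter to position 1,
   that of the input. *)
pose g := system_form (dren succn f); pose m := enc g.
have satP : fin_sat (And g (numeral m)) <-> halts_zero Q m.
  rewrite /g system_spec; split=> [[u [u0 u1]]|hm].
    rewrite dsat_ren => fu; have := fP (fun i => u i.*2.+1); rewrite u1 => -[_]; apply.
    exists (fun i => u i.*2.+2).
    have -> // : merge (fun i => u i.*2.+1) (fun i => u i.*2.+2) = u \o succn.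
    by apply: funext_odd_even => i; rewrite mergeE.
  have [w fw] := (fP (fun=> m)).1 hm.
  exists (scons 1 (merge (fun=> m) w)); split=> //.
  by rewrite dsat_ren.
have := closed_half_system (dren succn f) m; rewrite -/g => /and4P[wfF nx ny half].
have sentF : sentence (And g (numeral m)) by apply/and3P.
have haltP := halts_zero_prepend P (bs_csubst g).
(* Answer 1 makes [P] also halt with 0 on the same code, against determinism; answer 0 makes the
   sentence satisfiable. *)
case: (decides _ sentF half) => k [hk [[sat one]|[unsat zero]]].
  have [j [hj zero]] := (haltP.1 (satP.1 sat)).
  have := run_halted hk j; rewrite addnC (run_halted hj) => e.
  by rewrite -e zero in one.
by apply: unsat; apply/satP/haltP; exists k.
Qed.

Theorem mainTheorem5 :
  (~ exists P : program,
       forall f : form, sentence f -> rm_answers P (enc f) (fin_sat f)) /\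
  (~ exists P : program,
       forall f : form, sentence f -> only_half f ->
         rm_answers P (enc f) (fin_sat f)).
Proof.
split; last exact: no_half_decider.
case=> P decides; apply: no_half_decider.
by exists P => f sf _; apply: decides.
Qed.
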